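(* Let $N\in\mathbb Z_{>0}$, $k\in\mathbb Z_{\ge0}$, and $m\in\frac52+\frac12\mathbb Z_{\ge0}$. If $m\in\frac52+\mathbb Z_{\ge0}$, let $\Gamma$ be a subgroup of $\mathbf\Gamma(N)$ such that $\Gamma\cap K=\{1\}$; if $m\in\mathbb Z_{\ge3}$, let $\Gamma$ be a subgroup of $\Gamma(N)$ such that $\#(\Gamma\cap\mathrm{SO}_2(\mathbb R))\mid m+2k$. Then $P_\Gamma F_{k,m}$ is not identically $0$ if one of the following holds: (1) $k=0$ and $N>4\cdot2^{\frac1{m-2}}\sqrt{4^{\frac1{m-2}}-1}$; (2) $m=4$ and $N>\dfrac4{2^{\frac1{k+2}}-2^{-\frac1{k+2}}}$; (3) $0<k\le m-4$ and $N\ge4\sqrt{\frac{k+2}{m-2}\left(1+\frac{k+2}{m-2}\right)}$; (4) $0<m-4\le k$ and $N\ge4\sqrt{\frac k{m-4}\left(1+\frac k{m-4}\right)}$.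
   Context: $\Gamma(N)=\left\{\begin{pmatrix}a&b\\c&d\end{pmatrix}\in\mathrm{SL}_2(\mathbb Z):a,d\equiv1,\ b,c\equiv0\ (\mathrm{mod}\ N)\right\}$. Let $\mathcal H=\{z\in\mathbb C:\Im z>0\}$, $\mathrm{Hol}(\mathcal H)$ the space of holomorphic functions on $\mathcal H$, and $g.z=\frac{az+b}{cz+d}$, $j(g,z)=cz+d$ for $g=\begin{pmatrix}a&b\\c&d\end{pmatrix}$. The metaplectic group is $\mathrm{SL}_2(\mathbb R)^\sim=\{\sigma=(g_\sigma,\eta_\sigma)\in\mathrm{SL}_2(\mathbb R)\times\mathrm{Hol}(\mathcal H):\eta_\sigma(z)^2=j(g_\sigma,z)\ \forall z\in\mathcal H\}$ with multiplication $\sigma_1\sigma_2=(g_{\sigma_1}g_{\sigma_2},\ \eta_{\sigma_1}(g_{\sigma_2}.z)\eta_{\sigma_2}(z))$; it is a double cover of $\mathrm{SL}_2(\mathbb R)$ via $\pi_1(\sigma)=g_\sigma$. $K=\pi_1^{-1}(\mathrm{SO}_2(\mathbb R))$ and $\mathbf\Gamma(N)=\pi_1^{-1}(\Gamma(N))$. An element $\sigma$ is determined by $(g_\sigma,\eta_\sigma(i))$, and we write $\sigma\equiv(g_\sigma,\eta_\sigma(i))$. Put $\kappa_t=\left(\begin{pmatrix}\cos t&-\sin t\\\sin t&\cos t\end{pmatrix},e^{it/2}\right)$ for $t\in\mathbb R$ and $h_t=\left(\begin{pmatrix}e^t&0\\0&e^{-t}\end{pmatrix},e^{-t/2}\right)$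 for $t\ge0$; every element of $\mathrm{SL}_2(\mathbb R)^\sim$ is of the form $\kappa_{\theta_1}h_t\kappa_{\theta_2}$. The function $F_{k,m}$ is defined as follows ($\tanh^0(t)=1$). If $m$ is half-integral ($m\in\frac12+\mathbb Z$), $F_{k,m}:\mathrm{SL}_2(\mathbb R)^\sim\to\mathbb C$ is given by $F_{k,m}(\kappa_{\theta_1}h_t\kappa_{\theta_2})=e^{-i(m+2k)\theta_1}\frac{\tanh^k(t)}{\cosh^m(t)}e^{-im\theta_2}$ for $\theta_1,\theta_2\in\mathbb R$, $t\ge0$ (equivalently, $F_{k,m}(\sigma)=f_{k,m}(g_\sigma.i)\eta_\sigma(i)^{-2m}$ with $f_{k,m}(z)=(2i)^m\frac{(z-i)^k}{(z+i)^{m+k}}$, where $z^m:=(\sqrt z)^{2m}$ with $\sqrt{\cdot}$ the branch with values in $\{\Re>0\}\cup\{\Re=0,\Im\ge0\}$). If $m\in\mathbb Z$, $F_{k,m}:\mathrm{SL}_2(\mathbb R)\to\mathbb C$ is given by $F_{k,m}(\pi_1(\kappa_{\theta_1}h_t\kappa_{\theta_2}))=e^{-i(m+2k)\theta_1}\frac{\tanh^k(t)}{\cosh^m(t)}e^{-im\theta_2}$. In both cases $(P_\Gamma F_{k,m})(g)=\sum_{\gamma\in\Gamma}F_{k,m}(\gamma g)$, for $g$ in the respective group. *)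

(* Defs.v *)
From HB Require Import structures.
From mathcomp Require Import all_boot all_order all_algebra finmap complex.
From mathcomp Require Import ring.
From mathcomp Require Import all_classical all_reals all_analysis.

Set Implicit Arguments.
Unset Strict Implicit.
Unset Printing Implicit Defensive.

Import Order.TTheory GRing.Theory Num.Theory complex.
Import numFieldNormedType.Exports.

Local Open Scope classical_set_scope.
Local Open Scope complex_scope.
Local Open Scope ring_scope.

Section SL2.
Variable R : realType.

Record SL2 := MkSL2 { sl2_mx :> 'M[R]_2; _ : \det sl2_mx == 1 }.

HB.instance Definition _ := [isSub for sl2_mx].
HB.instance Definition _ := [Choice of SL2 by <:].

Lemma sl2_det (g : SL2) : \det g = 1.
Proof. by case: g => g /= /eqP. Qed.

Fact sl2_one_subproof : \det (1%:M : 'M[R]_2) == 1.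
Proof. by rewrite det1. Qed.

Fact sl2_mul_subproof (g h : SL2) : \det (g *m h) == 1.
Proof. by rewrite det_mulmx !sl2_det mulr1. Qed.

Fact sl2_inv_subproof (g : SL2) : \det (invmx g) == 1.
Proof. by rewrite det_inv sl2_det invr1. Qed.

Definition sl2_one := MkSL2 sl2_one_subproof.
Definition sl2_mul g h := MkSL2 (sl2_mul_subproof g h).
Definition sl2_inv g := MkSL2 (sl2_inv_subproof g).

Fact sl2_mulA : associative sl2_mul.
Proof. by move=> x y z; apply/val_inj; rewrite /= mulmxA. Qed.
Fact sl2_mul1g : left_id sl2_one sl2_mul.
Proof. by move=> x; apply/val_inj; rewrite /= mul1mx. Qed.
Fact sl2_mulg1 : right_id sl2_one sl2_mul.
Proof. by move=> x; apply/val_inj; rewrite /= mulmx1. Qed.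
Fact sl2_unit (g : SL2) : (g : 'M[R]_2) \in unitmx.
Proof. by rewrite unitmxE sl2_det unitr1. Qed.
Fact sl2_mulVg : left_inverse sl2_one sl2_inv sl2_mul.
Proof. by move=> x; apply/val_inj; rewrite /= mulVmx// sl2_unit. Qed.
Fact sl2_mulgV : right_inverse sl2_one sl2_inv sl2_mul.
Proof. by move=> x; apply/val_inj; rewrite /= mulmxV// sl2_unit. Qed.

HB.instance Definition _ := isGroup.Build SL2
  sl2_mulA sl2_mul1g sl2_mulg1 sl2_mulVg sl2_mulgV.

End SL2.

Section UpperHalfPlane.
Variable R : realType.
Implicit Types (g : SL2 R).

Record uhp := MkUhp { uhp_val :> R[i]; _ : 0 < Im uhp_val }.

HB.instance Definition _ := [isSub for uhp_val].
HB.instance Definition _ := [Choice of uhp by <:].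

Lemma uhp_gt0 (z : uhp) : 0 < Im z.
Proof. by case: z. Qed.

Fact uhp_i_subproof : 0 < Im ('i%C : R[i]).
Proof. by rewrite /= ltr01. Qed.
Definition uhp_i := MkUhp uhp_i_subproof.

(* The automorphy factor j. *)
Definition jfac g (z : R[i]) : R[i] := (g 1 0)%:C * z + (g 1 1)%:C.

Definition mobius g (z : R[i]) : R[i] :=
  ((g 0 0)%:C * z + (g 0 1)%:C) / jfac g z.

Lemma sl2_detE g : g 0 0 * g 1 1 - g 0 1 * g 1 0 = 1.
Proof.
have e1 : lift 0 0 = 1 :> 'I_2 by exact: val_inj.
have e0 : lift 1 0 = 0 :> 'I_2 by exact: val_inj.
rewrite -(sl2_det g) (expand_det_row _ 0) !big_ord_recl big_ord0 addr0.
rewrite /cofactor /= !det_mx11 !mxE e1 e0 expr0 expr1 mul1r mulN1r mulrN.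
by [].
Qed.

Lemma jfac_neq0 g (z : uhp) : jfac g z != 0.
Proof.
apply/eqP; case: z => -[x y] /= y0; rewrite /jfac; simpc => /eqP.
rewrite eq_complex /= => /andP[/eqP h1].
rewrite mulf_eq0 (gt_eqF y0) orbF => /eqP c0.
move: h1 (sl2_detE g); rewrite c0 mul0r add0r => ->.
by rewrite !mulr0 subr0 => /esym/eqP; rewrite oner_eq0.
Qed.

Fact mobius_subproof g (z : uhp) : 0 < Im (mobius g z).
Proof.
have := jfac_neq0 g z; rewrite /mobius.
case: z => -[x y] /= y0; have dE := sl2_detE g; rewrite /jfac; simpc.
set c := g 1 0; set d := g 1 1; set a := g 0 0; set b := g 0 1.
rewrite eq_complex /= negb_and => nz.
have n0 : 0 < (c * x + d) ^+ 2 + (c * y) ^+ 2.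
  rewrite lt_def addr_ge0 ?sqr_ge0// andbT paddr_eq0 ?sqr_ge0//.
  by rewrite !sqrf_eq0 negb_and.
rewrite -/a -/b -/c -/d in dE.
move: (_ + _ : R) n0 => t t0.
rewrite (_ : - _ + _ = y / t) ?divr_gt0// -[RHS]mul1r -dE.
by ring.
Qed.

Definition uhp_act g (z : uhp) : uhp := MkUhp (mobius_subproof g z).

Lemma uhp_act1 z : uhp_act 1%g z = z.
Proof.
apply/val_inj; rewrite /= /mobius /jfac /= !mxE /=.
by rewrite mul1r mul0r addr0 add0r divr1.
Qed.

Lemma sl2_mulE g h i j : (g * h)%g i j = g i 0 * h 0 j + g i 1 * h 1 j.
Proof.
have e1 : lift ord0 ord0 = 1 :> 'I_2 by exact: val_inj.
by rewrite [LHS]mxE !big_ord_recl big_ord0 addr0 e1.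
Qed.

Lemma jfacM g h (z : uhp) : jfac (g * h)%g z = jfac g (uhp_act h z) * jfac h z.
Proof.
have := jfac_neq0 h z; rewrite /= /mobius /jfac !sl2_mulE => hz.
by rewrite !rmorphD !rmorphM /=; field.
Qed.

Lemma uhp_actM g h z : uhp_act (g * h)%g z = uhp_act g (uhp_act h z).
Proof.
apply/val_inj => /=; set w := mobius h z.
have hz := jfac_neq0 h z; have ghz : jfac g w != 0 := jfac_neq0 g (uhp_act h z).
transitivity (((g 0 0)%:C * w + (g 0 1)%:C) * jfac h z / (jfac g w * jfac h z)).
  rewrite /mobius jfacM; congr (_ / _).
  rewrite /w /mobius !sl2_mulE !rmorphD !rmorphM /= /jfac.
  by field.
by rewrite -mulf_div divff// mulr1.
Qed.

(* The value outside the upper half-plane is irrelevant below: complex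
   differentiability is a local notion and the half-plane is open. *)
Definition ext0 (f : uhp -> R[i]) (w : R[i]) : R[i] :=
  if insub w is Some z then f z else 0.

(* R[i]^o is R[i] seen as a normed space over itself, so that [derivable _ z 1]
   is the existence of the complex derivative at z. *)
Definition holomorphic (f : uhp -> R[i]) :=
  forall z : uhp, derivable (ext0 f : (R[i])^o -> (R[i])^o) (val z : (R[i])^o) 1.

Lemma ext0E f (z : uhp) : ext0 f (val z) = f z.
Proof. by rewrite /ext0 valK. Qed.

Local Notation C := (R[i])^o.

Lemma Im_lt_norm (w : R[i]) y : `|w| < y%:C -> `|Im w| < y.
Proof.
rewrite -ltcR; apply: le_lt_trans.
have := normc_ge_Re (w * 'i%C); rewrite ReiNIm normrN => /le_trans; apply.
by rewrite normrM complexiE normCi mulr1.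
Qed.

Lemma near_uhp (z : uhp) : \forall h \near (0 : C)^', 0 < Im (h + val z).
Proof.
have y0 : 0 < (Im (val z))%:C by rewrite ltcR uhp_gt0.
apply: filterS (@dnbhs0_lt _ C _ y0) => h /Im_lt_norm.
by rewrite raddfD /= ltr_norml => /andP[+ _]; rewrite -subr_gt0 opprK.
Qed.

Lemma holomorphicP (f : uhp -> R[i]) (F : C -> C) :
  (forall z : uhp, F (val z) = f z) ->
  (forall z : uhp, differentiable F (val z : C)) -> holomorphic f.
Proof.
move=> Ff dF z; have /cvg_ex[l Fl] := (derivable1_diffP F (val z : C)).2 (dF z).
apply/cvg_ex; exists l; apply: cvg_trans Fl; apply: near_eq_cvg.
apply: filterS (near_uhp z) => h hz /=.
rewrite ext0E -Ff scaler1.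
by rewrite /shift /= -[h + val z]/(val (MkUhp hz)) ext0E -(Ff _).
Qed.

Lemma holomorphic_diff f (z : uhp) :
  holomorphic f -> differentiable (ext0 f : C -> C) (val z : C).
Proof. by move=> hf; apply/derivable1_diffP. Qed.

Lemma jfac_diff g (w : R[i]) : differentiable (jfac g : C -> C) (w : C).
Proof.
apply: differentiableD; last exact: differentiable_cst.
by apply: differentiableM; [exact: differentiable_cst|].
Qed.

Lemma mobius_diff g (z : uhp) : differentiable (mobius g : C -> C) (val z : C).
Proof.
apply: (@differentiableM _ _ (fun w : C => (g 0 0)%:C * w + (g 0 1)%:C)
  (fun w => (jfac g w)^-1)).
  apply: differentiableD; last exact: differentiable_cst.
  by apply: differentiableM; [exact: differentiable_cst|].
by apply: differentiableV; [exact: jfac_diff|exact: jfac_neq0].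
Qed.

Lemma holomorphicM f1 f2 : holomorphic f1 -> holomorphic f2 ->
  holomorphic (fun z => f1 z * f2 z).
Proof.
move=> h1 h2; apply: (@holomorphicP _ (fun w => ext0 f1 w * ext0 f2 w)) => z.
  by rewrite !ext0E.
by apply: differentiableM; exact: holomorphic_diff.
Qed.

Lemma holomorphicV f : holomorphic f -> (forall z, f z != 0) ->
  holomorphic (fun z => (f z)^-1).
Proof.
move=> hf f0; apply: (@holomorphicP _ (fun w => (ext0 f w)^-1)) => z.
  by rewrite !ext0E.
by apply: differentiableV; [exact: holomorphic_diff|rewrite ext0E].
Qed.

Lemma holomorphic_act f g : holomorphic f -> holomorphic (fun z => f (uhp_act g z)).
Proof.
move=> hf; apply: (@holomorphicP _ (fun w => ext0 f (mobius g w))) => z.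
  by rewrite -[mobius g _]/(val (uhp_act g z)) ext0E.
apply: (@differentiable_comp _ _ _ _ (mobius g : C -> C) (ext0 f : C -> C)).
  exact: mobius_diff.
exact: (@holomorphic_diff f (uhp_act g z)).
Qed.

Lemma holomorphic_cst c : holomorphic (fun=> c).
Proof.
by apply: (@holomorphicP _ (cst c)) => // z; exact: differentiable_cst.
Qed.

Lemma Re_sqrtc_ge0 (w : R[i]) : 0 <= Re (sqrtc w).
Proof. by case: w => a b /=; exact: sqrtr_ge0. Qed.

Lemma Re_sqrtc_gt0 (w : R[i]) : Im w != 0 -> 0 < Re (sqrtc w).
Proof.
rewrite lt_neqAle Re_sqrtc_ge0 andbT; apply: contra_neq.
rewrite -{2}(sqr_sqrtc w) expr2; case: (sqrtc w) => a b /= <-.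
by rewrite mul0r mulr0 addr0.
Qed.

Lemma Re_le_norm (w : R[i]) : (Re w)%:C <= `|w|.
Proof. by apply: le_trans (normc_ge_Re w); rewrite lecR ler_norm. Qed.

Lemma sqrtc_derivable (w : R[i]) : 0 < Re (sqrtc w) ->
  derivable (@sqrtc R : C -> C) (w : C) 1.
Proof.
move=> r0; set r := sqrtc w in r0 *.
have sN0 (u : R[i]) : sqrtc u + r != 0.
  apply: contraTneq r0 => /(congr1 (@Re R)); rewrite raddfD /= => e.
  by rewrite -leNgt -e lerDr Re_sqrtc_ge0.
have dE (h : R[i]) : sqrtc (h + w) - r = h / (sqrtc (h + w) + r).
  apply: (mulIf (sN0 (h + w))); rewrite mulfVK// -subr_sqr !sqr_sqrtc.
  by rewrite addrK.
have sC : (fun h : C => sqrtc (h + w) + r : C) @ (0 : C)^' --> (r + r : C).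
  apply: cvgD; last exact: cvg_cst.
  apply/(@cvgrPdistC_lt _ C) => e e0.
  have re0 : 0 < e * (Re r)%:C by rewrite mulr_gt0// ltcR.
  apply: filterS (@dnbhs0_lt _ C _ re0) => h hlt.
  have nr : (Re r)%:C <= `|sqrtc (h + w) + r|.
    apply: le_trans (Re_le_norm _); rewrite lecR raddfD lerDr.
    exact: Re_sqrtc_ge0.
  rewrite dE normrM normfV ltr_pdivrMr ?normr_gt0//.
  by apply: lt_le_trans hlt _; rewrite ler_pM2l.
have r2 : (r + r : C) != 0 := sN0 w.
apply/cvg_ex; exists ((r + r)^-1 : C).
apply: cvg_trans (cvgV r2 sC); apply: near_eq_cvg.
apply: filterS (nbhs_dnbhs_neq (0 : C)) => h h0 /=.
by rewrite scaler1 /shift /= -/r dE [RHS]mulrA mulVf// mul1r.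
Qed.

Lemma jfac_sqrt_exists g (w : R[i]) : w ^+ 2 = jfac g (val uhp_i) ->
  exists2 f, holomorphic f & (forall z, f z ^+ 2 = jfac g (val z)) /\ f uhp_i = w.
Proof.
move=> wE; have [c0|c0] := eqVneq (g 1 0) 0.
  exists (fun=> w); first exact: (@holomorphic_cst w).
  by split=> // z; rewrite wE /jfac c0 !mul0r.
pose f0 (z : uhp) := sqrtc (jfac g (val z)).
have f0hol : holomorphic f0.
  apply: (@holomorphicP _ (fun u => sqrtc (jfac g u))) => // z.
  apply: (@differentiable_comp _ _ _ _ (jfac g : C -> C) (@sqrtc R : C -> C)).
    exact: jfac_diff.
  apply/derivable1_diffP/sqrtc_derivable/Re_sqrtc_gt0.
  case: z => -[x y] /= y0; rewrite /jfac; simpc => /=.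
  by rewrite mulf_neq0// gt_eqF.
have : f0 uhp_i ^+ 2 == w ^+ 2 by rewrite wE sqr_sqrtc.
rewrite eqf_sqr => /orP[]/eqP f0i.
  by exists f0 => //; split=> // z; rewrite sqr_sqrtc.
exists (fun z => -1 * f0 z).
  exact: (@holomorphicM (fun=> -1) f0 (@holomorphic_cst (-1)) f0hol).
split=> [z|]; rewrite mulN1r; last by rewrite f0i opprK.
by rewrite sqrrN sqr_sqrtc.
Qed.

End UpperHalfPlane.

Section Metaplectic.
Variable R : realType.

(* The metaplectic double cover of SL_2(R). *)
Record Mp2 := MkMp2 {
  mp2_sl2 : SL2 R;
  mp2_eta : uhp R -> R[i];
  mp2_hol : holomorphic mp2_eta;
  mp2_sqr : forall z, mp2_eta z ^+ 2 = jfac mp2_sl2 z }.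

Arguments mp2_hol : clear implicits.

HB.instance Definition _ := gen_eqMixin Mp2.
HB.instance Definition _ := gen_choiceMixin Mp2.

Lemma mp2P (s t : Mp2) :
  mp2_sl2 s = mp2_sl2 t -> mp2_eta s =1 mp2_eta t -> s = t.
Proof.
case: s t => [g e h1 s1] [g' e' h2 s2] /= gE /funext eE.
rewrite -{g'}gE -{e'}eE in h2 s2 *.
by congr MkMp2; exact: Prop_irrelevance.
Qed.

Lemma mp2_eta_neq0 (s : Mp2) z : mp2_eta s z != 0.
Proof. by rewrite -sqrf_eq0 mp2_sqr jfac_neq0. Qed.

Fact mp2_one_sqr z : (1 : R[i]) ^+ 2 = jfac (1%g : SL2 R) z.
Proof. by rewrite /jfac !mxE /= mul0r add0r expr1n. Qed.

Definition mp2_one := MkMp2 (@holomorphic_cst R 1) mp2_one_sqr.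

Fact mp2_mul_sqr (s t : Mp2) (z : uhp R) :
  (mp2_eta s (uhp_act (mp2_sl2 t) z) * mp2_eta t z) ^+ 2 =
  jfac (mp2_sl2 s * mp2_sl2 t)%g z.
Proof. by rewrite exprMn !mp2_sqr jfacM. Qed.

Definition mp2_mul (s t : Mp2) := MkMp2
  (holomorphicM (holomorphic_act (g := mp2_sl2 t) (mp2_hol s)) (mp2_hol t))
  (mp2_mul_sqr s t).

Fact mp2_inv_hol (s : Mp2) :
  holomorphic (fun z => (mp2_eta s (uhp_act (mp2_sl2 s)^-1%g z))^-1).
Proof.
apply: (holomorphicV (f := fun z => mp2_eta s (uhp_act (mp2_sl2 s)^-1%g z))).
  exact/holomorphic_act/mp2_hol.
by move=> z; exact: mp2_eta_neq0.
Qed.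

Fact mp2_inv_sqr (s : Mp2) (z : uhp R) :
  (mp2_eta s (uhp_act (mp2_sl2 s)^-1%g z))^-1 ^+ 2 = jfac (mp2_sl2 s)^-1%g z.
Proof.
have nz := jfac_neq0 (mp2_sl2 s) (uhp_act (mp2_sl2 s)^-1%g z).
rewrite exprVn mp2_sqr; apply: (mulfI nz); rewrite divff//.
by rewrite -jfacM mulgV -mp2_one_sqr expr1n.
Qed.

Definition mp2_inv (s : Mp2) := MkMp2 (@mp2_inv_hol s) (mp2_inv_sqr s).

Fact mp2_mulA : associative mp2_mul.
Proof. by move=> s t u; apply: mp2P => [|z] /=; rewrite ?mulgA// uhp_actM mulrA. Qed.
Fact mp2_mul1g : left_id mp2_one mp2_mul.
Proof. by move=> s; apply: mp2P => [|z] /=; rewrite ?mul1g// mul1r. Qed.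
Fact mp2_mulg1 : right_id mp2_one mp2_mul.
Proof. by move=> s; apply: mp2P => [|z] /=; rewrite ?mulg1// uhp_act1 mulr1. Qed.
Fact mp2_mulVg : left_inverse mp2_one mp2_inv mp2_mul.
Proof.
move=> s; apply: mp2P => [|z] /=; rewrite ?mulVg//.
by rewrite -uhp_actM mulVg uhp_act1 mulVf// mp2_eta_neq0.
Qed.
Fact mp2_mulgV : right_inverse mp2_one mp2_inv mp2_mul.
Proof.
by move=> s; apply: mp2P => [|z] /=; rewrite ?mulgV// divff// mp2_eta_neq0.
Qed.

HB.instance Definition _ := isGroup.Build Mp2
  mp2_mulA mp2_mul1g mp2_mulg1 mp2_mulVg mp2_mulgV.

End Metaplectic.

Section Series.
Variables (R : realType) (I : choiceType).

(* Unconditional summation, i.e. convergence along the net of finite subsets of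
   A; over the complex numbers this is the same as absolute convergence.  The sum
   of a family that is not summable is set to 0, so that a statement that a sum
   is nonzero includes its convergence. *)
Definition has_sum (A : set I) (f : I -> R[i]) (s : R[i]) :=
  forall e : R, 0 < e -> exists2 X0 : {fset I}, [set` X0] `<=` A &
    forall X : {fset I}, (X0 `<=` X)%fset -> [set` X] `<=` A ->
      `|\sum_(i <- X) f i - s| < e%:C.

Definition usum (A : set I) (f : I -> R[i]) : R[i] := xget 0 (has_sum A f).

Lemma usumE (A : set I) (f : I -> R[i]) s : has_sum A f s -> usum A f = s.
Proof.
move=> fs; have fu : has_sum A f (usum A f) by exact: (xgetI 0 fs).
apply/eqP; rewrite -subr_eq0 -normr_le0; apply/negPn/negP.
set d := `|_|; have dr : (Re d)%:C = d by rewrite RRe_real ?normr_real.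
rewrite -real_ltNge ?real0 ?normr_real// -dr ltcR => d0.
have d20 : 0 < Re d / 2 by rewrite divr_gt0.
have [X0 X0A hX] := fs _ d20; have [Y0 Y0A hY] := fu _ d20.
have XYA : [set` (X0 `|` Y0)%fset] `<=` A.
  by move=> x /=; rewrite in_fsetU => /orP[/X0A|/Y0A].
have /= h1 := hX _ (fsubsetUl X0 Y0) XYA.
have /= h2 := hY _ (fsubsetUr X0 Y0) XYA.
have : d < d.
  rewrite {1}/d -[X in X < _](distrC s).
  apply: (le_lt_trans (ler_distD (\sum_(i <- (X0 `|` Y0)%fset) f i) _ _)).
  by rewrite (distrC s) -dr (splitr (Re d)) rmorphD ltrD.
by rewrite ltxx.
Qed.

End Series.

Section Poincare.
Variable R : realType.

(* The element s with coordinates (g_s, eta_s(i)) = (g, w): it exists as soon as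
   w ^+ 2 = j(g, i) (mp2_ofE), and is unique because eta_s is then determined up
   to a sign by its square on the connected upper half-plane. *)
Definition mp2_of (g : SL2 R) (w : R[i]) : Mp2 R :=
  xget 1%g [set s | mp2_sl2 s = g /\ mp2_eta s (uhp_i R) = w].

Lemma mp2_ofE g w : w ^+ 2 = jfac g (val (uhp_i R)) ->
  mp2_sl2 (mp2_of g w) = g /\ mp2_eta (mp2_of g w) (uhp_i R) = w.
Proof.
move=> /jfac_sqrt_exists[f fhol [f2 fi]].
exact: (@xgetPex _ 1%g [set s | mp2_sl2 s = g /\ mp2_eta s (uhp_i R) = w]
  (ex_intro _ (MkMp2 fhol f2) (conj erefl fi))).
Qed.

Definition mx22 (a b c d : R) : 'M[R]_2 :=
  \matrix_(i, j) if i == 0 then (if j == 0 then a else b)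
                 else (if j == 0 then c else d).

Lemma det_mx22 a b c d : \det (mx22 a b c d) = a * d - b * c.
Proof.
rewrite (expand_det_row _ 0) !big_ord_recl big_ord0 addr0.
by rewrite /cofactor /= !det_mx11 !mxE /= expr0 expr1 mul1r mulN1r mulrN.
Qed.

Fact rot_subproof (t : R) : \det (mx22 (cos t) (- sin t) (sin t) (cos t)) == 1.
Proof. by rewrite det_mx22 mulNr opprK -!expr2 cos2Dsin2. Qed.

Definition rot t := MkSL2 (rot_subproof t).

Fact dil_subproof (t : R) : \det (mx22 (expR t) 0 0 (expR (- t))) == 1.
Proof. by rewrite det_mx22 mul0r subr0 expRxMexpNx_1. Qed.

Definition dil t := MkSL2 (dil_subproof t).

Definition expi (t : R) : R[i] := cos t +i* sin t.

Definition kappa (t : R) : Mp2 R := mp2_of (rot t) (expi (t / 2)).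

Definition hyp (t : R) : Mp2 R := mp2_of (dil t) (expR (- t / 2))%:C.

Lemma kappaE t : mp2_sl2 (kappa t) = rot t /\
  mp2_eta (kappa t) (uhp_i R) = expi (t / 2).
Proof.
apply: mp2_ofE; rewrite /jfac /= !mxE /expi expr2; simpc.
rewrite [in RHS](splitr t) cosD sinD.
by rewrite [X in _ +i* X]addrC.
Qed.

Lemma hypE t : mp2_sl2 (hyp t) = dil t /\
  mp2_eta (hyp t) (uhp_i R) = (expR (- t / 2))%:C.
Proof.
apply: mp2_ofE; rewrite /jfac /= !mxE /= mul0r add0r -rmorphXn /=.
by rewrite expr2 -expRD -splitr.
Qed.

Definition cosh (t : R) := (expR t + expR (- t)) / 2.
Definition sinh (t : R) := (expR t - expR (- t)) / 2.
Definition tanh (t : R) := sinh t / cosh t.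

Definition Fval (k : nat) (m th1 t th2 : R) : R[i] :=
  expi (- ((m + 2 * k%:R) * th1)) * (tanh t ^+ k / cosh t `^ m)%:C *
  expi (- (m * th2)).

(* F_{k,m} given by its values in the coordinates kappa th1 * hyp t * kappa th2
   (t >= 0), in which every element can be written.  These coordinates are not
   unique, but Fval does not depend on their choice: on the metaplectic group
   when m is half-integral, and on SL_2(R) when m is an integer.  Fhalf and Fint
   are to be used only in the respective case. *)
Definition Fhalf (k : nat) (m : R) (s : Mp2 R) : R[i] :=
  xget 0 [set w | exists th1 t th2, [/\ 0 <= t,
    s = (kappa th1 * hyp t * kappa th2)%g & w = Fval k m th1 t th2]].

Definition Fint (k : nat) (m : R) (g : SL2 R) : R[i] :=
  xget 0 [set w | exists th1 t th2, [/\ 0 <= t,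
    g = mp2_sl2 (kappa th1 * hyp t * kappa th2)%g & w = Fval k m th1 t th2]].

Definition poincare (G : groupType) (Gam : set G) (F : G -> R[i]) (g : G) : R[i] :=
  usum Gam (fun gam => F (gam * g)%g).

Definition SO2 : set (SL2 R) := [set g | (g : 'M[R]_2) *m g^T = 1%:M].

Definition Gamma (N : nat) : set (SL2 R) :=
  [set g | exists A : 'M[int]_2, (g : 'M[R]_2) = map_mx intr A /\
     [/\ (A 0%R 0%R = 1 %[mod N])%Z, (A 1%R 1%R = 1 %[mod N])%Z,
         (A 0%R 1%R = 0 %[mod N])%Z & (A 1%R 0%R = 0 %[mod N])%Z]].

Definition Kmp : set (Mp2 R) := @mp2_sl2 R @^-1` SO2.

Definition Gammamp (N : nat) : set (Mp2 R) := @mp2_sl2 R @^-1` Gamma N.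

End Poincare.

Arguments SO2 : clear implicits.
Arguments Gamma : clear implicits.
Arguments Kmp : clear implicits.
Arguments Gammamp : clear implicits.

(* Main.v *)
(* If P_Gamma F vanishes identically, then |F(g)| is at most the sum of
   |F(gamma g)| over the gamma outside K (divided by #(Gamma cap SO_2) in the
   integral case, where the terms from Gamma cap SO_2 all equal F(g)).  Only |F|
   matters from here on: it is a function phi(u) of u = sinh^2 t, so the
   inequality lives on the hyperbolic plane.  Integrate it over a disc
   C = {u < u0}.  If 16 u0 (1 + u0) <= N^2, the discs gamma C overlap only
   for gammas in the same coset of Gamma cap K, because every gamma in Gamma(N)
   outside SO_2 satisfies 4 sinh^2 t >= N^2.  Unfolding gives that the integral of
   |F| over C is at most that over the complement.  The hyperbolic area is a
   multiple of du, so this is a contradiction as soon as u0 exceeds the median of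
   phi(u) du.  The median is explicit in cases (1) and (2); in cases (3) and (4)
   u / (1 + u) is beta distributed, and its median is bounded by the mean,
   respectively the mode, through a pointwise comparison of the density with its
   reflection. *)

Require Import Defs.
From mathcomp Require Import all_boot all_order all_algebra finmap complex.
From mathcomp Require Import ring lra.
From mathcomp Require Import all_classical all_reals all_analysis.
From mathcomp Require Import measurable_realfun.

Set Implicit Arguments.
Unset Strict Implicit.
Unset Printing Implicit Defensive.

Import Order.TTheory GRing.Theory Num.Theory.
Import numFieldNormedType.Exports.

Local Open Scope classical_set_scope.
Local Open Scope ring_scope.

(** * Invariant measure *)

(** Since [usum] gives a divergent family the value 0, nonvanishing includes convergence. Both come
    from one estimate: at some point every finite sum of |F| over elements outside K is at most some
    [M] that is smaller than the total contribution of Gamma cap K. No fundamental domain is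
    involved: the unfolding is a termwise change of variables in a Tonelli sum over Gamma, which
    makes sense even where the series diverges. It rests on an invariant measure and on a formula
    for integrals of radial functions, both obtained in coordinates where the measure is Lebesgue
    measure on the plane. The radial formula is established for continuous functions, so the
    indicator of the disc is replaced by a continuous cutoff; the room for it is the gap between the
    bound for the median and u0. That gap must be nonempty although conditions (3) and (4) allow
    equality: there the bound is rational, and equality would make N^2 + 4 a square, which is
    impossible for N > 0. *)

Section Invariance.
Variable R : realType.
Local Notation mu := (@lebesgue_measure R).
Local Notation P := (measurableTypeR R * measurableTypeR R)%type.
Local Notation mu2 := (mu \x mu)%E.
Implicit Types (g h : SL2 R) (x y : P).

Lemma ge0_integral_translate (c : R) (f : R -> \bar R) :
  measurable_fun setT (f : measurableTypeR R -> \bar R) -> (forall t, 0 <= f t)%E ->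
  (\int[mu]_t f (t + c)%R = \int[mu]_t f t)%E.
Proof.
move=> mf f0.
have mt : measurable_fun setT ((fun t => t + c) : measurableTypeR R -> measurableTypeR R).
  exact: measurable_funD.
have E A : measurable A ->
    pushforward mu ((fun t => t + c) : _ -> measurableTypeR R) A = mu A.
  move=> mA; apply/esym/lebesgue_measure_unique => //= _ [[a b]] _ <-.
  rewrite /pushforward.
  have -> : (fun t => t + c) @^-1` `]a, b]%classic = `](a - c), (b - c)]%classic.
    by apply/seteqP; split=> t /=; rewrite !in_itv/= ltrBlDr lerBrDr.
  rewrite !lebesgue_measure_itv/= !lte_fin ltrD2r; case: ifP => // _.
  by rewrite -!EFinD; congr EFin; ring.
transitivity (\int[mu]_(t in ((fun t : R => t + c)%R : _ -> measurableTypeR R) @^-1` setT) (f \o (fun t : R => t + c)%R) t)%E; first by [].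
rewrite -(@ge0_integral_pushforward _ _ _ _ R _ mt mu setT f)//.
by apply: eq_measure_integral => //= A mA _; exact: E.
Qed.

Lemma ge0_integral_reflect (f : R -> \bar R) :
  measurable_fun setT (f : measurableTypeR R -> \bar R) -> (forall t, 0 <= f t)%E ->
  (\int[mu]_t f (- t)%R = \int[mu]_t f t)%E.
Proof.
move=> mf f0.
have mt : measurable_fun setT (-%R : measurableTypeR R -> measurableTypeR R).
  exact: oppr_measurable.
transitivity (\int[mu]_(t in (-%R : _ -> measurableTypeR R) @^-1` setT) (f \o -%R) t)%E; first by [].
rewrite -(@ge0_integral_pushforward _ _ _ _ R _ mt mu setT f)//.
by apply: eq_measure_integral => //= A mA _; exact: lebesgue_measureN.
Qed.

(* The point (q, v) stands for the symmetric matrix X = [[p, q], [q, e^v]] with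
   p = (1 + q^2) e^-v, i.e. for the point (q + i) e^-v of the upper half-plane,
   and g acts by X |-> g X g^T.  In these coordinates the invariant measure is
   Lebesgue measure. *)
Definition quad g x : R :=
  g 1 0 ^+ 2 * ((1 + x.1 ^+ 2) * expR (- x.2)) + 2 * g 1 0 * g 1 1 * x.1
  + g 1 1 ^+ 2 * expR x.2.

Definition act g x : P :=
  (g 0 0 * g 1 0 * ((1 + x.1 ^+ 2) * expR (- x.2))
   + (g 0 0 * g 1 1 + g 0 1 * g 1 0) * x.1 + g 0 1 * g 1 1 * expR x.2,
   ln (quad g x)).

(* sinh^2 of half the hyperbolic distance to i *)
Definition hdist x : R := ((1 + x.1 ^+ 2) * expR (- x.2) + expR x.2 - 2) / 4.

Lemma quad_gt0 g x : 0 < quad g x.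
Proof.
rewrite /quad; case: x => q v /=; rewrite expRN.
have := expR_gt0 v; set r := expR v => r0.
have -> : g 1 0 ^+ 2 * ((1 + q ^+ 2) * r^-1) + 2 * g 1 0 * g 1 1 * q + g 1 1 ^+ 2 * r
  = ((g 1 0 * q + g 1 1 * r) ^+ 2 + g 1 0 ^+ 2) / r by field; rewrite gt_eqF.
rewrite divr_gt0// lt_def addr_ge0 ?sqr_ge0// andbT.
rewrite paddr_eq0 ?sqr_ge0// !sqrf_eq0 negb_and.
have [c0|c0] := eqVneq (g 1 0) 0; last by rewrite orbT.
rewrite c0 mul0r add0r orbF mulf_eq0 negb_or (lt0r_neq0 r0) andbT.
by apply/eqP => d0; have /eqP := sl2_detE g; rewrite c0 d0 !mulr0 subr0 eq_sym oner_eq0.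
Qed.

Lemma act_bot g x : expR (act g x).2 = quad g x.
Proof. by rewrite /= lnK ?posrE ?quad_gt0. Qed.

(* The matrix attached to [act g x] again has determinant 1, so its upper left
   entry is the one of [g X g^T]. *)
Lemma act_top g x : (1 + (act g x).1 ^+ 2) * expR (- (act g x).2) =
  g 0 0 ^+ 2 * ((1 + x.1 ^+ 2) * expR (- x.2)) + 2 * g 0 0 * g 0 1 * x.1
  + g 0 1 ^+ 2 * expR x.2.
Proof.
rewrite expRN act_bot /act /=.
have := quad_gt0 g x; rewrite /quad; case: x => q v /=; rewrite expRN.
have := expR_gt0 v; set r := expR v => r0.
set Q := _ + _ + _ => Q0; apply: (mulIf (lt0r_neq0 Q0)); rewrite mulfVK ?gt_eqF//.
rewrite -[X in X + _](_ : (g 0 0 * g 1 1 - g 0 1 * g 1 0) ^+ 2 = 1); last first.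
  by rewrite sl2_detE expr1n.
by rewrite /Q; field; rewrite gt_eqF.
Qed.

Lemma act1 x : act 1%g x = x.
Proof.
case: x => q v; rewrite /act /quad /= !mxE /=; congr (_, _); first by ring.
by rewrite mulr1n !mulr0n expr1n expr0n /= !(mul0r, mul1r, add0r, mulr0) expRK.
Qed.

(** By [act_top] and [act_bot] the three entries of the matrix attached to [act h x] are those of h
    X h^T, so both sides are polynomial in the matrix entries. *)
Lemma actM g h x : act (g * h)%g x = act g (act h x).
Proof.
rewrite [LHS]/act [act g _]/act; congr (_, _); last congr ln.
  rewrite act_top act_bot /act /quad /= !sl2_mulE.
  ring.
rewrite [RHS]/quad act_top act_bot /act /quad /= !sl2_mulE.
ring.
Qed.

Lemma hdist_act g x : hdist (act g x) =
  ((g 0 0 ^+ 2 + g 1 0 ^+ 2) * ((1 + x.1 ^+ 2) * expR (- x.2)) +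
   2 * (g 0 0 * g 0 1 + g 1 0 * g 1 1) * x.1 +
   (g 0 1 ^+ 2 + g 1 1 ^+ 2) * expR x.2 - 2) / 4.
Proof. by rewrite /hdist act_top act_bot /quad; congr (_ / _); ring. Qed.

Lemma measurable_hdist : measurable_fun [set: P] hdist.
Proof.
apply: measurable_funM => //; apply: measurable_funB => //.
apply: measurable_funD; last by apply: measurableT_comp.
apply: measurable_funM.
  by apply: measurable_funD => //; apply: measurable_funX.
by do 2!apply: measurableT_comp => //.
Qed.

Lemma measurable_quad g : measurable_fun [set: P] (quad g).
Proof.
apply: measurable_funD.
  apply: measurable_funD.
    apply: measurable_funM => //; apply: measurable_funM.
      by apply: measurable_funD => //; apply: measurable_funX.
    by do 2!apply: measurableT_comp => //.
  by apply: measurable_funM.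
by apply: measurable_funM => //; apply: measurableT_comp.
Qed.

Lemma measurable_act g : measurable_fun [set: P] (act g).
Proof.
apply/measurable_fun_pairP; split.
  apply: measurable_funD.
    apply: measurable_funD.
      apply: measurable_funM => //; apply: measurable_funM.
        by apply: measurable_funD => //; apply: measurable_funX.
      by do 2!apply: measurableT_comp => //.
    by apply: measurable_funM.
  by apply: measurable_funM => //; apply: measurableT_comp.
exact: (measurableT_comp (@measurable_ln R) (measurable_quad g)).
Qed.

Definition act_invariant g := forall H : P -> \bar R,
  measurable_fun [set: P] H -> (forall x, 0 <= H x)%E ->
  (\int[mu2]_x H (act g x) = \int[mu2]_x H x)%E.

Lemma act_invariantM g h :
  act_invariant g -> act_invariant h -> act_invariant (g * h)%g.
Proof.
move=> ig ih H mH H0; have mHg := measurableT_comp mH (measurable_act g).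
transitivity (\int[mu2]_x (H \o act g) (act h x))%E.
  by apply: eq_integral => x _; rewrite actM.
by rewrite (ih _ mHg) ?(ig _ mH) // => x; exact: H0.
Qed.

Lemma act_upper g x : g 1 0 = 0 ->
  act g x = (x.1 + g 0 1 * g 1 1 * expR x.2, x.2 + ln (g 1 1 ^+ 2)).
Proof.
move=> c0; have := sl2_detE g; rewrite c0 mulr0 subr0 => ad.
have d0 : g 1 1 != 0.
  by apply/eqP => d0; move/eqP: ad; rewrite d0 mulr0 eq_sym oner_eq0.
rewrite /act /quad c0 !(mulr0, mul0r, add0r, expr0n) /= ?(mul0r, add0r, addr0).
rewrite ad mul1r; congr (_, _).
by rewrite lnM ?posrE ?expR_gt0 ?exprn_even_gt0// expRK addrC.
Qed.

(** An upper triangular matrix translates v by a constant and q by an amount depending on v alone.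
    Integrating over q first makes both changes translations. *)
Lemma act_upper_invariant g : g 1 0 = 0 -> act_invariant g.
Proof.
move=> c0 H mH H0.
under eq_integral do rewrite act_upper//.
set b := g 0 1 * g 1 1; set c := ln _.
have mq (v : R) : measurable_fun setT ((fun q : R => H (q, v)) : measurableTypeR R -> _).
  exact: (@measurable_fun_pair1 _ _ _ _ _ _ H v mH).
have mv (q : R) : measurable_fun setT ((fun v : R => H (q, v)) : measurableTypeR R -> _).
  exact: (@measurable_fun_pair2 _ _ _ _ _ _ H q mH).
have mHc : measurable_fun [set: P] (fun x : P => H (x.1, x.2 + c)).
  apply: (measurableT_comp mH); apply/measurable_fun_pairP; split => /=; first exact: measurable_fst.
  exact: measurable_funD.
rewrite (@fubini_tonelli2 _ _ _ _ _ mu mu); last 2 first.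
- apply: (measurableT_comp mH); apply/measurable_fun_pairP; split => /=.
    apply: measurable_funD => //; apply: measurable_funM => //.
    by apply: measurableT_comp.
  exact: measurable_funD.
- by move=> x; exact: H0.
transitivity (\int[mu]_v \int[mu]_q H (q, v + c)%R)%E.
  apply: eq_integral => v _; rewrite /fubini_G/=.
  by apply: (ge0_integral_translate (b * expR v) (mq (v + c))) => q; exact: H0.
rewrite -(@fubini_tonelli2 _ _ _ _ _ mu mu _ mHc)//.
rewrite (@fubini_tonelli1 _ _ _ _ _ mu mu _ mHc)//.
apply: etrans (esym (@fubini_tonelli1 _ _ _ _ _ mu mu H mH H0)).
apply: eq_integral => q _; rewrite /fubini_F/=.
by apply: (ge0_integral_translate c (mv q)) => v; exact: H0.
Qed.

(** The inversion is q -> -q, v -> ln (1 + q^2) - v. Integrating over v first, it is a reflection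
    and a translation in v, then a reflection in q. *)
Lemma act_weyl_invariant g : g 0 0 = 0 -> g 0 1 = -1 -> g 1 0 = 1 -> g 1 1 = 0 ->
  act_invariant g.
Proof.
move=> ga gb gc gd H mH H0.
have E x : act g x = (- x.1, ln (1 + x.1 ^+ 2) - x.2).
  rewrite /act /quad ga gb gc gd !(mulr0, mul0r, add0r, addr0, expr0n, expr1n, mul1r, mulr1) /=.
  rewrite ?(mul0r, addr0) mulN1r; congr (_, _).
  by rewrite lnM ?posrE ?expR_gt0 ?ltr_pwDl ?sqr_ge0// expRK.
under eq_integral do rewrite E.
have m1 : measurable_fun [set: P] (fun x : P => (- x.1, ln (1 + x.1 ^+ 2) - x.2) : P).
  apply/measurable_fun_pairP; split => /=; first by apply: (measurableT_comp (@oppr_measurable R setT)); exact: measurable_fst.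
  apply: measurable_funB => //; apply: (measurableT_comp (@measurable_ln R)).
  by apply: measurable_funD => //; apply: measurable_funX.
have m2 : measurable_fun [set: P] (fun x : P => H (- x.1, x.2)).
  apply: (measurableT_comp mH); apply/measurable_fun_pairP; split => /=; last exact: measurable_snd.
  by apply: (measurableT_comp (@oppr_measurable R setT)); exact: measurable_fst.
rewrite (@fubini_tonelli1 _ _ _ _ _ mu mu); last 2 first.
- exact: (measurableT_comp mH m1).
- by move=> x; exact: H0.
have mv (q : R) : measurable_fun setT ((fun v : R => H (q, v)) : measurableTypeR R -> _).
  exact: (@measurable_fun_pair2 _ _ _ _ _ _ H q mH).
have mq (v : R) : measurable_fun setT ((fun q : R => H (q, v)) : measurableTypeR R -> _).
  exact: (@measurable_fun_pair1 _ _ _ _ _ _ H v mH).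
transitivity (\int[mu]_q \int[mu]_v H (- q, v)%R)%E.
  apply: eq_integral => q _; rewrite /fubini_F/=.
  have mN : measurable_fun setT ((fun v : R => H (- q, - v)) : measurableTypeR R -> _).
    exact: measurableT_comp (mv (- q)) (@oppr_measurable R setT).
  rewrite -(ge0_integral_reflect (mv (- q)) (fun v => H0 _)).
  rewrite -(ge0_integral_translate (- ln (1 + q ^+ 2)) mN (fun v => H0 _)).
  by apply: eq_integral => v _; rewrite opprD opprK addrC.
rewrite -(@fubini_tonelli1 _ _ _ _ _ mu mu _ m2)//.
rewrite (@fubini_tonelli2 _ _ _ _ _ mu mu _ m2)//.
apply: etrans (esym (@fubini_tonelli2 _ _ _ _ _ mu mu H mH H0)).
apply: eq_integral => v _; rewrite /fubini_G/=.
by apply: (ge0_integral_reflect (mq v)) => q; exact: H0.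
Qed.

Lemma ex_SL2 (a b c d : R) : a * d - b * c = 1 ->
  exists g, [/\ g 0 0 = a, g 0 1 = b, g 1 0 = c & g 1 1 = d].
Proof.
move=> e; have D : \det (mx22 a b c d) == 1 by rewrite det_mx22 e.
by exists (MkSL2 D); rewrite /= !mxE.
Qed.

Lemma SL2P g h : g 0 0 = h 0 0 -> g 0 1 = h 0 1 -> g 1 0 = h 1 0 -> g 1 1 = h 1 1 ->
  g = h.
Proof.
move=> e00 e01 e10 e11; apply/val_inj/matrixP => i j /=.
have o (k : 'I_2) : k = 0 \/ k = 1.
  by case: k => [[|[|//]] k2]; [left|right]; exact/val_inj.
by case: (o i) => ->; case: (o j) => ->.
Qed.

Lemma act_invariantP g : act_invariant g.
Proof.
(* Bruhat decomposition *)
have [c0|c0] := eqVneq (g 1 0) 0; first exact: act_upper_invariant.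
have [t [ta tb tc td]] := @ex_SL2 1 (g 0 0 / g 1 0) 0 1 ltac:(by ring).
have [w [wa wb wc wd]] := @ex_SL2 0 (-1) 1 0 ltac:(by ring).
have [u [ua ub uc ud]] := @ex_SL2 (g 1 0) (g 1 1) 0 (g 1 0)^-1 ltac:(by field).
have -> : g = (t * (w * u))%g.
  apply: SL2P; rewrite !sl2_mulE !(ta, tb, tc, td, wa, wb, wc, wd, ua, ub, uc, ud); try by field.
  have := sl2_detE g => e; apply: (mulfI c0); move: e; set A := g 0 0.
  set B := g 0 1; set C := g 1 0 in c0 *; set D := g 1 1 => e.
  by rewrite (_ : C * B = A * D - 1); [field|rewrite -e; ring].
exact: (act_invariantM (act_upper_invariant tc)
  (act_invariantM (act_weyl_invariant wa wb wc wd) (act_upper_invariant uc))).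
Qed.

End Invariance.

(** * Radial integrals *)

Section Radial.
Variable R : realType.
Local Notation mu := (@lebesgue_measure R).
Local Notation P := (measurableTypeR R * measurableTypeR R)%type.
Local Notation mu2 := (mu \x mu)%E.
Local Open Scope ring_scope.

Lemma ge0_even_integralT (f : R -> \bar R) :
  measurable_fun setT (f : measurableTypeR R -> \bar R) -> (forall t, 0 <= f t)%E ->
  (forall t, f (- t) = f t) ->
  (\int[mu]_t f t = 2%:E * \int[mu]_(t in `]0%R, +oo[) f t)%E.
Proof.
move=> mf f0 fN.
have -> : [set: R] = `]-oo, 0%R]%classic `|` `]0%R, +oo[%classic.
  by rewrite -(@itv_setU_setT _ R false 0).
rewrite ge0_integral_setU//=; last 2 first.
  exact: measurable_funS mf.
  by rewrite disj_set2E; apply/eqP/seteqP; split=> // x /= []; rewrite !in_itv/= andbT; case: ltgtP.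
under [X in (X + _)%E]eq_integral do rewrite -fN.
rewrite -ge0_integration_by_substitution0//.
rewrite -integral_itv_obnd_cbnd; last exact: measurable_funS mf.
by rewrite -[X in (X + X)%E]mul1e -ge0_muleDl// -EFinD.
Qed.

Lemma is_derive_gt0_lt (F dF : R -> R) :
  (forall x : R, is_derive x 1 F (dF x)) -> (forall x, 0 < dF x) ->
  {homo F : x y / x < y}.
Proof.
move=> FdF dF0 x y xy; rewrite -subr_gt0.
have [c _ ->] := @MVT _ F dF x y xy (fun z _ => FdF z)
  (derivable_within_continuous (fun z _ => @ex_derive _ _ _ _ _ _ _ (FdF z))).
by rewrite mulr_gt0// subr_gt0.
Qed.

(* [hypv q w] is the v for which (q, v) lies on the geodesic ray of slope w from
   the base point, and [hyptau q w] is cosh of the distance of that point. *)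
Definition hyptau (q w : R) : R := Num.sqrt (1 + q ^+ 2 * (1 + w ^+ 2)).

Lemma hyptau_arg_gt0 (q w : R) : 0 < 1 + q ^+ 2 * (1 + w ^+ 2).
Proof. by rewrite ltr_pwDl// mulr_ge0 ?sqr_ge0// addr_ge0// sqr_ge0. Qed.

Lemma hyptau_gt0 (q w : R) : 0 < hyptau q w.
Proof. by rewrite sqrtr_gt0 hyptau_arg_gt0. Qed.

Lemma sqr_hyptau (q w : R) : hyptau q w ^+ 2 = 1 + q ^+ 2 * (1 + w ^+ 2).
Proof. by rewrite sqr_sqrtr// ltW// hyptau_arg_gt0. Qed.

Lemma hyptau_gt (q w : R) : `|q * w| < hyptau q w.
Proof.
rewrite -(@ltr_pXn2r _ 2) ?nnegrE// ?(ltW (hyptau_gt0 _ _))//.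
rewrite sqr_hyptau real_normK ?num_real// exprMn ltr_pwDl//.
by rewrite mulrDr mulr1 lerDr sqr_ge0.
Qed.

Definition hypv (q w : R) : R := ln (hyptau q w + q * w).

Lemma hypv_arg_gt0 (q w : R) : 0 < hyptau q w + q * w.
Proof. by have := hyptau_gt q w; rewrite ltr_norml -subr_gt0 opprK addrC => /andP[]. Qed.

Lemma hdist_hypv (q w : R) : hdist (q, hypv q w) = (hyptau q w - 1) / 2.
Proof.
rewrite /hdist /= expRN lnK ?posrE ?hypv_arg_gt0//.
have p0 := hypv_arg_gt0 q w; have := sqr_hyptau q w.
set t := hyptau q w in p0 *; set p := t + q * w in p0 * => tE.
have -> : 1 + q ^+ 2 = (t - q * w) * p by rewrite /p -subr_sqr tE; ring.
by rewrite mulfK ?gt_eqF// /p; field.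
Qed.

Lemma is_derive_hyptau (q w : R) :
  is_derive w 1 (hyptau q) (q ^+ 2 * w / hyptau q w).
Proof.
have := is_derive1_sqrt (hyptau_arg_gt0 q w) => H.
have H2 : is_derive w 1 (fun w : R => 1 + q ^+ 2 * (1 + w ^+ 2)) (2 * q ^+ 2 * w).
  by apply: is_derive_eq; rewrite !scaler1 /GRing.scale/= ; ring.
have := @is_derive1_comp _ _ _ w _ _ H H2; rewrite -/(hyptau q w) => D.
apply: (@is_derive_eq _ _ _ _ _ _ _ _ D).
by field; rewrite gt_eqF// hyptau_gt0.
Qed.

Lemma is_derive_hypv (q w : R) : is_derive w 1 (hypv q) (q / hyptau q w).
Proof.
have H := is_derive1_ln (hypv_arg_gt0 q w).
have H1 := is_derive_hyptau q w.
have H2 : is_derive w 1 (fun w : R => hyptau q w + q * w) (q ^+ 2 * w / hyptau q w + q).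
  by apply: is_derive_eq; rewrite /GRing.scale/= mulr1.
apply: (@is_derive_eq _ _ _ _ _ _ _ _ (@is_derive1_comp _ _ _ w _ _ H H2)).
field; rewrite !gt_eqF// ?hyptau_gt0 ?hypv_arg_gt0//.
Qed.

Lemma continuous_hyptau (q : R) : continuous (hyptau q).
Proof.
move=> w; apply: differentiable_continuous; apply/derivable1_diffP.
exact: (@ex_derive _ _ _ _ _ _ _ (is_derive_hyptau q w)).
Qed.

(** For fixed q > 0, [hypv q] is an increasing bijection of the line with derivative
    [q / hyptau q w]. The slope w takes the place of the angle of polar coordinates. *)
Lemma hypv_subst (h : R -> R) (q : R) : continuous h -> (forall u, 0 <= h u) -> 0 < q ->
  (\int[mu]_v (h (hdist (q, v)))%:E =
   \int[mu]_w (h ((hyptau q w - 1) / 2) * (q / hyptau q w))%:E)%E.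
Proof.
move=> ch h0 q0.
have dE : derive1 (hypv q) = fun w => q / hyptau q w.
  apply/funext => w; rewrite derive1E; have := is_derive_hypv q w.
  by move=> ?; rewrite derive_val.
have d0 w : 0 <= q / hyptau q w by rewrite divr_ge0 ?ltW ?hyptau_gt0.
have lb w : q * `|w| < hyptau q w.
  by have := hyptau_gt q w; rewrite normrM (gtr0_norm q0).
rewrite (@increasing_ge0_integration_by_substitutionT _ (hypv q)).
- by apply: eq_integral => w _; rewrite dE -hdist_hypv.
- apply: (is_derive_gt0_lt (fun w => is_derive_hypv q w)) => w.
  by rewrite divr_gt0// hyptau_gt0.
- rewrite dE => w; apply: cvgM; first exact: cvg_cst.
  by apply: cvgV; [rewrite gt_eqF// hyptau_gt0|exact: continuous_hyptau].
- rewrite dE; apply/cvg_ex; exists 0; apply/cvgrPdist_le => e e0; near=> w.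
  rewrite sub0r normrN ger0_norm//.
  rewrite ler_pdivrMr ?hyptau_gt0//; apply: le_trans (ler_wpM2l (ltW e0) (ltW (lb w))).
  rewrite mulrCA ler_pMr// -ler_pdivrMl// mulr1 ler_normr; apply/orP; right.
  by rewrite lerNr; near: w; apply: nbhs_ninfty_le; rewrite num_real.
- rewrite dE; apply/cvg_ex; exists 0; apply/cvgrPdist_le => e e0; near=> w.
  rewrite sub0r normrN ger0_norm//.
  rewrite ler_pdivrMr ?hyptau_gt0//; apply: le_trans (ler_wpM2l (ltW e0) (ltW (lb w))).
  rewrite mulrCA ler_pMr// -ler_pdivrMl// mulr1 ler_normr; apply/orP; left.
  by near: w; apply: nbhs_pinfty_ge; rewrite num_real.
- by move=> w; exact: (@ex_derive _ _ _ _ _ _ _ (is_derive_hypv q w)).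
- apply/cvgrNyPle => A; near=> w.
  have w0 : w < 0 by near: w; apply: nbhs_ninfty_lt; rewrite num_real.
  rewrite /hypv -[leRHS]expRK ler_ln ?posrE ?hypv_arg_gt0 ?expR_gt0//.
  have t1 : 0 < hyptau q w - q * w.
    by rewrite -mulrN addr_gt0 ?hyptau_gt0// mulr_gt0// oppr_gt0.
  have -> : hyptau q w + q * w = (1 + q ^+ 2) / (hyptau q w - q * w).
    by apply: (mulIf (lt0r_neq0 t1)); rewrite mulfVK ?gt_eqF// mulrC -subr_sqr sqr_hyptau; ring.
  rewrite ler_pdivrMr// -ler_pdivrMl ?expR_gt0//.
  apply: (@le_trans _ _ (- (q * w))); last by rewrite lerDr ltW// hyptau_gt0.
  by rewrite -mulrN -ler_pdivrMl// lerNr; near: w; apply: nbhs_ninfty_le; rewrite num_real.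
- apply/cvgryPge => A; near=> w.
  have w0 : 0 < w by near: w; apply: nbhs_pinfty_gt; rewrite num_real.
  rewrite /hypv -[leLHS]expRK ler_ln ?posrE ?hypv_arg_gt0 ?expR_gt0//.
  apply: (@le_trans _ _ (q * w)); last by rewrite lerDr ltW// hyptau_gt0.
  by rewrite -ler_pdivrMl//; near: w; apply: nbhs_pinfty_ge; rewrite num_real.
- move=> v; apply: continuous_comp; last exact: ch.
  rewrite /hdist /=; apply: cvgM; last exact: cvg_cst.
  apply: cvgB; last exact: cvg_cst.
  apply: cvgD; last exact: continuous_expR.
  apply: cvgM; first exact: cvg_cst.
  by apply: continuous_comp; [exact: opp_continuous|exact: continuous_expR].
- by move=> v; exact: h0.
Unshelve. all: by end_near. Qed.

(** For fixed slope, u = (hyptau - 1) / 2 has derivative (1 + w^2) q / (2 hyptau) in q. This absorbs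
    the Jacobian left by [hypv_subst], and the dependence on w splits off as a factor. *)
Lemma hypu_subst (h : R -> R) (w : R) : continuous h -> (forall u, 0 <= h u) ->
  (\int[mu]_(q in `[0%R, +oo[) (h ((hyptau q w - 1) / 2) * (q / hyptau q w))%:E =
   (2 / (1 + w ^+ 2))%:E * \int[mu]_(u in `[0%R, +oo[) (h u)%:E)%E.
Proof.
move=> ch h0; pose s : R := 1 + w ^+ 2.
have s0 : 0 < s by rewrite ltr_pwDl// sqr_ge0.
pose F (q : R) := (hyptau q w - 1) / 2.
have dF (q : R) : is_derive q 1 F (s * q / hyptau q w / 2).
  have H := is_derive1_sqrt (hyptau_arg_gt0 q w).
  have H2 : is_derive q 1 (fun q : R => 1 + q ^+ 2 * (1 + w ^+ 2)) (2 * q * s).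
    by apply: is_derive_eq; rewrite /GRing.scale/= /s; ring.
  have H3 := @is_derive1_comp _ _ _ q _ _ H H2.
  rewrite -[Num.sqrt (1 + _)]/(hyptau q w) in H3.
  rewrite /F; apply: is_derive_eq.
  by rewrite /GRing.scale/=; field; rewrite gt_eqF// hyptau_gt0.
have dE : derive1 F = fun q => s * q / hyptau q w / 2.
  by apply/funext => q; rewrite derive1E; have := dF q => ?; rewrite derive_val.
have cF : continuous F.
  by move=> q; apply: differentiable_continuous; apply/derivable1_diffP; exact: ex_derive.
have ct : continuous (fun q => hyptau q w).
  move=> q; have -> : (fun q => hyptau q w) = (fun q => 2 * F q + 1).
    by apply/funext => t; rewrite /F; field.
  apply: cvgD; last exact: cvg_cst.
  by apply: cvgM; [exact: cvg_cst|exact: cF].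
have cd : continuous (derive1 F).
  rewrite dE => q; apply: cvgM; last exact: cvg_cst.
  apply: cvgM; first by apply: cvgM; [exact: cvg_cst|exact: cvg_id].
  by apply: cvgV; [rewrite gt_eqF// hyptau_gt0|exact: ct].
have F0 : F 0 = 0 by rewrite /F /hyptau expr0n /= mul0r addr0 sqrtr1 subrr mul0r.
rewrite -{2}F0 (@increasing_ge0_integration_by_substitutiony _ F).

- have mG : measurable_fun setT (((h \o F) * derive1 F)%R : measurableTypeR R -> R).
    apply: continuous_measurable_fun => q; apply: cvgM; last exact: cd.
    by apply: continuous_comp; [exact: cF|exact: ch].
  rewrite -ge0_integralZl//=; last 3 first.
  + by apply/measurable_EFinP; apply: measurable_funTS.
  + move=> q qI; have q0 : 0 <= q by move: qI; rewrite /= in_itv/= andbT.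
    rewrite lee_fin dE.
    rewrite -[X in 0 <= X]/(h (F q) * (s * q / hyptau q w / 2)).
    by rewrite !mulr_ge0 ?invr_ge0 ?(ltW s0) ?(ltW (hyptau_gt0 _ _)).
  + by rewrite lee_fin divr_ge0// ltW.
  apply: eq_integral => q _; rewrite -EFinM dE; congr EFin.
  rewrite -[RHS]/(_ * (h (F q) * (s * q / hyptau q w / 2))) -/(F q) -/s.
  by field; rewrite !gt_eqF// hyptau_gt0.
- move=> x y; rewrite !in_itv/= !andbT => x0 y0 xy.
  rewrite /F ltr_pM2r// ltrD2r ltr_sqrt ?hyptau_arg_gt0// ltrD2l.
  by rewrite ltr_pM2r// ltr_pXn2r.
- by move=> x _; exact: cd.
- apply/cvg_ex; exists (derive1 F 0).
  by apply: cvg_at_right_filter; exact: cd.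
(* The derivative has limit sqrt s / 2 at infinity, because t q < hyptau <= 1 + t q. *)
- rewrite dE; pose t := Num.sqrt s.
  have t0 : 0 < t by rewrite sqrtr_gt0.
  have tE : t ^+ 2 = s by rewrite sqr_sqrtr// ltW.
  apply/cvg_ex; exists (t / 2); apply/cvgrPdist_le => e e0; near=> q.
  have q0 : 0 < q by near: q; apply: nbhs_pinfty_gt; rewrite num_real.
  have tau0 := hyptau_gt0 q w.
  have tauE : hyptau q w ^+ 2 = 1 + (t * q) ^+ 2.
    by rewrite sqr_hyptau exprMn tE mulrC.
  have l1 : t * q < hyptau q w.
    by rewrite -(@ltr_pXn2r _ 2) ?nnegrE ?mulr_ge0 ?ltW// tauE ltrDr.
  have l2 : hyptau q w <= 1 + t * q.
    rewrite -(@ler_pXn2r _ 2) ?nnegrE ?addr_ge0 ?mulr_ge0 ?(ltW t0) ?(ltW q0) ?(ltW tau0)// tauE.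
    by rewrite sqrrD expr1n lerD2r lerDl mul1r pmulrn_lge0// mulr_ge0 ?(ltW t0) ?(ltW q0).
  have -> : t / 2 - s * q / hyptau q w / 2 = t * (hyptau q w - t * q) / hyptau q w / 2.
    by rewrite -tE; field; rewrite gt_eqF.
  rewrite ger0_norm; last first.
    by rewrite !mulr_ge0 ?invr_ge0 ?subr_ge0 ?ltW.
  rewrite ler_pdivrMr// ler_pdivrMr//.
  have h1 : t * (hyptau q w - t * q) <= t by rewrite ler_piMr ?(ltW t0)// lerBlDl addrC.
  apply: (le_trans h1); apply: (@le_trans _ _ (e * 2 * (t * q))); last first.
    by rewrite ler_pM2l ?mulr_gt0// (ltW l1).
  rewrite mulrCA ler_pMr// -ler_pdivrMl; last by rewrite mulr_gt0.
  rewrite mulr1.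
  by near: q; apply: nbhs_pinfty_ge; rewrite num_real.
- split; first by move=> q _; exact: (@ex_derive _ _ _ _ _ _ _ (dF q)).
  by apply: cvg_at_right_filter; exact: cF.
- apply/cvgryPge => A; near=> q.
  have q0 : 0 < q by near: q; apply: nbhs_pinfty_gt; rewrite num_real.
  rewrite /F ler_pdivlMr// lerBrDr; apply: (@le_trans _ _ q).
    by near: q; apply: nbhs_pinfty_ge; rewrite num_real.
  rewrite -(@ler_pXn2r _ 2) ?nnegrE ?(ltW q0) ?(ltW (hyptau_gt0 _ _))// sqr_hyptau.
  by have := mulr_ge0 (sqr_ge0 q) (sqr_ge0 w); rewrite mulrDr mulr1; lra.
- exact: continuous_subspaceT.
- by move=> x _; exact: h0.
Unshelve. all: by end_near. Qed.

Lemma measurable_hyptau :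
  measurable_fun setT ((fun x : R * R => hyptau x.1 x.2) : P -> R).
Proof.
apply: (measurableT_comp (continuous_measurable_fun (@sqrt_continuous R))).
apply: measurable_funD => //; apply: measurable_funM.
  by apply: measurable_funX; exact: measurable_fst.
by apply: measurable_funD => //; apply: measurable_funX; exact: measurable_snd.
Qed.

Lemma integral_oneDsqr :
  (\int[mu]_w ((1 + w ^+ 2)^-1)%:E = pi%:E)%E.
Proof.
have c (w : R) : 0 < 1 + w ^+ 2 by rewrite ltr_pwDl// sqr_ge0.
have mi : measurable_fun setT ((fun w : R => ((1 + w ^+ 2)^-1)%:E) : measurableTypeR R -> \bar R).
  by apply/measurable_EFinP; apply: continuous_measurable_fun; exact: continuous_oneDsqrV.
rewrite ge0_even_integralT//; last 2 first.
- by move=> w; rewrite lee_fin invr_ge0 ltW.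
- by move=> w; rewrite sqrrN.
rewrite integral_itv_obnd_cbnd; last exact: measurable_funTS.
by rewrite integral0y_oneDsqr -EFinM; congr EFin; field.
Qed.

(** Polar coordinates in two steps, with q restricted to the positive half-line by the symmetry q ->
    -q: v is traded for the slope w, then q for u. The angular part is 2 times the integral of 2 /
    (1 + w^2), that is, [4 * pi]. *)
Theorem integral_radial (h : R -> R) : continuous h -> (forall u, 0 <= h u) ->
  (\int[mu2]_x (h (hdist x))%:E =
   (4 * pi)%:E * \int[mu]_(u in `[0%R, +oo[) (h u)%:E)%E.
Proof.
move=> ch h0.
have mh := continuous_measurable_fun ch.
have mH : measurable_fun setT ((fun x => (h (hdist x))%:E) : P -> \bar R).
  by apply/measurable_EFinP; exact: (measurableT_comp mh (@measurable_hdist R)).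
rewrite (@fubini_tonelli1 _ _ _ _ _ mu mu _ mH)//; last by move=> x; rewrite lee_fin.
rewrite ge0_even_integralT; last 3 first.
- by apply: measurable_fun_fubini_tonelli_F => // x; rewrite lee_fin.
- by move=> q; apply: integral_ge0 => v _; rewrite lee_fin.
- move=> q; rewrite /fubini_F /=.
  by apply: eq_integral => v _; rewrite /hdist /= sqrrN.
(* [Num.max x.1 0] extends the integrand by zero to q <= 0, so that the order of integration can be
   exchanged over the whole plane. *)
pose K (x : R * R) : \bar R :=
  (h ((hyptau x.1 x.2 - 1) / 2) * (Num.max x.1 0 / hyptau x.1 x.2))%:E.
have K0 x : (0 <= K x)%E.
  by rewrite lee_fin mulr_ge0// divr_ge0 ?le_max ?lexx ?orbT// ltW// hyptau_gt0.
have mK : measurable_fun setT (K : P -> \bar R).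
  apply/measurable_EFinP; apply: measurable_funM.
    apply: (measurableT_comp mh); apply: measurable_funM => //.
    by apply: measurable_funB => //; exact: measurable_hyptau.
  apply: measurable_funM.
    by apply: measurable_maxr => //; exact: measurable_fst.
  have -> : (fun x : P => (hyptau x.1 x.2)^-1) = (fun x => (hyptau x.1 x.2) `^ (-1)).
    by apply/funext => x; rewrite powR_inv1// ltW// hyptau_gt0.
  exact: (measurableT_comp (@measurable_powR R (-1)) measurable_hyptau).
transitivity (2%:E * \int[mu]_q \int[mu]_w K (q, w))%E.
  congr (_ * _)%E; rewrite [LHS]integral_mkcond; apply: eq_integral => q _.
  have [q0|q0] := ltP 0 (q : R).
    rewrite patchE mem_set/=; last by rewrite in_itv/= q0.
    rewrite /fubini_F hypv_subst//.
    by apply: eq_integral => w _; rewrite /K /= max_l// ltW.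
  rewrite patchE memNset/=; last by rewrite in_itv/= andbT ltNge q0.
  rewrite integral0_eq// => w _.
  by rewrite /K /= max_r// mul0r mulr0.
rewrite -[X in (_ * X)%E](@fubini_tonelli1 _ _ _ _ _ mu mu _ mK K0).
rewrite (@fubini_tonelli2 _ _ _ _ _ mu mu _ mK K0).
set I := (\int[mu]_(u in `[0%R, +oo[) (h u)%:E)%E.
have I0 : (0 <= I)%E by apply: integral_ge0 => u _; rewrite lee_fin.
transitivity (2%:E * \int[mu]_w ((2 / (1 + w ^+ 2))%:E * I))%E.
  congr (_ * _)%E; apply: eq_integral => w _; rewrite -hypu_subst//.
  rewrite /fubini_G [RHS]integral_mkcond; apply: eq_integral => q _.
  have [q0|q0] := leP 0 (q : R).
    by rewrite patchE mem_set/= ?in_itv/= ?q0// /K /= max_l.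
  rewrite patchE memNset/=; last by rewrite in_itv/= andbT leNgt q0.
  by rewrite /K /= max_r ?mul0r ?mulr0// ltW.
have c (w : R) : 0 < 1 + w ^+ 2 by rewrite ltr_pwDl// sqr_ge0.
have mi : measurable_fun setT ((fun w : R => ((1 + w ^+ 2)^-1)%:E) : measurableTypeR R -> \bar R).
  by apply/measurable_EFinP; apply: continuous_measurable_fun; exact: continuous_oneDsqrV.
under eq_integral do rewrite EFinM -muleA [X in (_ * X)%E]muleC.
rewrite ge0_integralZl//; last 2 first.
- by apply: emeasurable_funM => //.
- by move=> w _; rewrite mule_ge0// lee_fin invr_ge0 ltW.
rewrite ge0_integralZl//; last 1 first.
- by move=> w _; rewrite lee_fin invr_ge0 ltW.
rewrite integral_oneDsqr (muleC I) !muleA -!EFinM; congr (_%:E * _)%E; ring.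
Qed.

End Radial.

(** * Medians *)

Section Median.
Variable R : realType.
Local Notation mu := (@lebesgue_measure R).
Implicit Types (u x kap : R).

(* |F_{k,m}| as a function of u = sinh^2 t *)
Definition prof (k : nat) (m u : R) : R :=
  Num.sqrt u ^+ k * (1 + `|u|) `^ (- ((m + k%:R) / 2)).

Lemma prof_ge0 k m u : 0 <= prof k m u.
Proof. by rewrite mulr_ge0 ?exprn_ge0 ?sqrtr_ge0 ?powR_ge0. Qed.

Lemma profE k m u : 0 < u ->
  prof k m u = expR (k%:R / 2 * ln u - (m + k%:R) / 2 * ln (1 + u)).
Proof.
move=> u0; rewrite /prof gtr0_norm// -powR12_sqrt ?ltW// /powR !gt_eqF//; last first.
  by rewrite addr_gt0.
by rewrite -expRM_natl -expRD; congr expR; field.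
Qed.

Lemma prof_gt0 k m u : 0 < u -> 0 < prof k m u.
Proof. by move=> u0; rewrite profE ?expR_gt0. Qed.

Lemma continuous_prof k m : continuous (prof k m).
Proof.
move=> u; rewrite /prof; apply: cvgM.
  apply: (@continuous_comp _ _ _ (@Num.sqrt R) (fun x => x ^+ k)).
    exact: sqrt_continuous.
  exact: exprn_continuous.
have p0 : 0 < 1 + `|u| by rewrite ltr_pwDl.
apply: (@continuous_comp _ _ _ (fun u : R => 1 + `|u|) (@powR R ^~ _)).
  by apply: cvgD; [exact: cvg_cst|exact: norm_continuous].
apply: differentiable_continuous; apply/derivable1_diffP.
by apply: derivable_powR; rewrite in_itv/= p0.
Qed.

Lemma is_derive_ge0_le (F dF : R -> R) (a : R) :
  (forall x, a <= x -> is_derive x (1 : R) F (dF x)) ->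
  (forall x, a <= x -> 0 <= dF x) ->
  forall x, a <= x -> F a <= F x.
Proof.
move=> FdF dF0 x; rewrite le_eqVlt => /predU1P[->//|ax]; rewrite -subr_ge0.
have [||c + ->] := @MVT _ F dF a x ax.
- by move=> z; rewrite in_itv/= => /andP[/ltW + _]; exact: FdF.
- apply: derivable_within_continuous => z; rewrite in_itv/= => /andP[az _].
  exact: (@ex_derive _ _ _ _ _ _ _ (FdF _ az)).
by rewrite in_itv/= => /andP[/ltW ac _]; rewrite mulr_ge0 ?dF0// subr_ge0 ltW.
Qed.

Lemma is_derive_ln_affine (a b x : R) : 0 < a * x + b ->
  is_derive x (1 : R) (fun t => ln (a * t + b)) (a / (a * x + b)).
Proof.
move=> p0; have H := is_derive1_ln p0.
have H2 : is_derive x 1 (fun t : R => a * t + b) a.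
  by apply: is_derive_eq; rewrite /GRing.scale/= mulr1 addr0.
apply: (@is_derive_eq _ _ _ _ _ _ _ _ (@is_derive1_comp _ _ _ x _ _ H H2)).
by rewrite mulrC.
Qed.

(* The pointwise comparison of the density at [x] and [kap ^+ 2 / x], in
   logarithmic form. *)
Lemma log_mean_ineq kap x : 0 < kap <= 1 -> kap <= x ->
  2 * kap / (1 + kap) * (ln x - ln kap) <=
  ln (1 + x) - (ln (x + kap ^+ 2) - ln x).
Proof.
move=> /andP[k0 k1] kx.
pose E x := ln (1 * x + 1) - ln (1 * x + kap ^+ 2)
  + (1 - kap) / (1 + kap) * ln (1 * x + 0).
pose dE x := 1 / (1 * x + 1) - 1 / (1 * x + kap ^+ 2)
  + (1 - kap) / (1 + kap) * (1 / (1 * x + 0)).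
have EE : E kap <= E x.
  apply: (@is_derive_ge0_le E dE kap) => // y ky.
    have y0 := lt_le_trans k0 ky.
    have H1 := @is_derive_ln_affine 1 1 y ltac:(by rewrite mul1r addr_gt0).
    have H2 := @is_derive_ln_affine 1 (kap ^+ 2) y ltac:(by rewrite mul1r addr_gt0// exprn_gt0).
    have H3 := @is_derive_ln_affine 1 0 y ltac:(by rewrite mul1r addr0).
    by apply: is_derive_eq.
  have y0 := lt_le_trans k0 ky.
  (* The coefficient [2 * kap / (1 + kap)] is the one for which the derivative vanishes at [kap].
     The zero is double, so the derivative does not change sign. *)
  have -> : dE y = (1 - kap) * (y - kap) ^+ 2 /
      ((1 + kap) * y * (1 + y) * (y + kap ^+ 2)).
    rewrite /dE; field; rewrite !gt_eqF// ?addr_gt0// ?exprn_gt0//.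
  by rewrite divr_ge0 ?mulr_ge0 ?sqr_ge0 ?subr_ge0 ?addr_ge0 ?sqr_ge0 ?(ltW k0) ?(ltW y0) ?ler01.
have x0 := lt_le_trans k0 kx.
move: EE; rewrite /E !mul1r !addr0.
have -> : kap + kap ^+ 2 = kap * (kap + 1) by ring.
rewrite (@lnM _ kap) ?posrE ?addr_gt0// (addrC x 1).
have -> : (1 - kap) / (1 + kap) = 1 - 2 * kap / (1 + kap).
  by field; rewrite gt_eqF// addr_gt0.
rewrite !mulrBl !mul1r mulrBr; lra.
Qed.

(* The same for the reflection of u / (1 + u) in kap / (1 + kap). *)
Lemma log_mode_ineq kap x : 1 <= kap -> kap <= x ->
  kap * ln x + (1 + kap) * ln (1 + kap) <=
  kap * ln ((kap - 1) * x + 2 * kap) + ln (2 * x + (1 - kap)).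
Proof.
move=> k1 kx; have k0 : 0 < kap := lt_le_trans ltr01 k1.
pose E x := kap * (ln ((kap - 1) * x + 2 * kap) - ln (1 * x + 0))
  + ln (2 * x + (1 - kap)).
pose dE x := kap * ((kap - 1) / ((kap - 1) * x + 2 * kap) - 1 / (1 * x + 0))
  + 2 / (2 * x + (1 - kap)).
have np y : kap <= y -> 0 < (kap - 1) * y + 2 * kap.
  move=> ky; rewrite ltr_wpDl ?mulr_gt0// mulr_ge0// ?subr_ge0//.
  by rewrite (le_trans _ ky)// ltW.
have dp y : kap <= y -> 0 < 2 * y + (1 - kap) by lra.
have EE : E kap <= E x.
  apply: (@is_derive_ge0_le E dE kap) => // y ky.
    have y0 := lt_le_trans k0 ky.
    have H1 := is_derive_ln_affine (np _ ky).
    have H2 := is_derive_ln_affine (dp _ ky).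
    have H3 := @is_derive_ln_affine 1 0 y ltac:(by rewrite mul1r addr0).
    by apply: is_derive_eq.
  have y0 := lt_le_trans k0 ky.
  have -> : dE y = 2 * ((kap - 1) * (y - kap) ^+ 2) /
      (((kap - 1) * y + 2 * kap) * y * (2 * y + (1 - kap))).
    rewrite /dE; field; rewrite !gt_eqF// ?np// ?dp//.
  rewrite divr_ge0// ?mulr_ge0 ?sqr_ge0 ?subr_ge0// ltW ?np ?dp//.
have x0 := lt_le_trans k0 kx.
move: EE; rewrite /E !mul1r !addr0.
have -> : (kap - 1) * kap + 2 * kap = kap * (1 + kap) by ring.
have -> : 2 * kap + (1 - kap) = 1 + kap by ring.
rewrite (@lnM _ kap) ?posrE ?addr_gt0//; lra.
Qed.

(* The bound on [P x + P 0] says that [kap] is at least the median of the density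
   [f] on the half-line. *)
Lemma median_lt (f P : R -> R) (kap kap' : R) :
  continuous f -> (forall u, 0 <= f u) -> (forall u, 0 < u -> 0 < f u) ->
  (forall u, 0 < u -> is_derive u (1 : R) P (f u)) -> P x @[x --> 0^'+] --> P 0 ->
  0 < kap -> (forall x, kap <= x -> P x + P 0 <= 2 * P kap) ->
  kap < kap' ->
  exists a b : R, [/\ (\int[mu]_(u in `[0%R, kap']) (f u)%:E = a%:E)%E,
    (\int[mu]_(u in `[kap', +oo[) (f u)%:E = b%:E)%E & b < a].
Proof.
move=> cf f0 fp dP P0 k0 med kk'.
have dPx u : 0 < u -> derivable P u 1.
  by move=> u0; exact: (@ex_derive _ _ _ _ _ _ _ (dP _ u0)).
have P'E u : 0 < u -> derive1 P u = f u.
  by move=> u0; rewrite derive1E; exact: (@derive_val _ _ _ _ _ _ _ (dP _ u0)).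
have cP u : 0 < u -> P x @[x --> u] --> P u.
  by move=> u0; apply: differentiable_continuous; apply/derivable1_diffP; exact: dPx.
have k'0 := lt_trans k0 kk'.
have Ple x y : 0 < x -> x <= y -> P x <= P y.
  move=> x0; apply: (@is_derive_ge0_le P f x) => z xz; last exact: f0.
  by apply: dP; exact: lt_le_trans xz.
have Pkk' : P kap < P kap'.
  rewrite -subr_gt0; have [||c + ->] := @MVT _ P f kap kap' kk'.
  - by move=> z; rewrite in_itv/= => /andP[kz _]; apply: dP; exact: lt_trans kz.
  - apply: derivable_within_continuous => z; rewrite in_itv/= => /andP[kz _].
    by apply: dPx; exact: lt_le_trans kz.
  rewrite in_itv/= => /andP[kc _]; rewrite mulr_gt0 ?subr_gt0//.
  by apply: fp; exact: lt_trans kc.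
(* Freezing [P] to the left of [kap'] gives a function monotone on the whole line, whose limit at
   infinity is its supremum. *)
pose Q x := P (Num.max x kap').
have ndQ : {homo Q : x y / x <= y}.
  move=> x y xy; apply: Ple; first by rewrite lt_max k'0 orbT.
  by rewrite ge_max !le_max xy lexx /= orbT.
pose l := sup (range Q).
have ubQ : ubound (range Q) (2 * P kap - P 0).
  move=> _ [x _ <-]; rewrite lerBrDr; apply: med.
  by rewrite le_max (ltW kk') orbT.
have cvP : P x @[x --> +oo] --> l.
  have : Q x @[x --> +oo] --> l.
    by apply: nondecreasing_cvgr => //; exists (2 * P kap - P 0).
  apply: cvg_trans; apply: near_eq_cvg; near=> x.
  by rewrite /Q max_l//; near: x; apply: nbhs_pinfty_ge; rewrite num_real.
have l_le : l <= 2 * P kap - P 0 by apply: ge_sup => //; exists (Q 0), 0.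
(* The difference of the two masses is 2 P kap' - P 0 - l >= 2 (P kap' - P kap), and this is
   positive because [kap < kap']. *)
exists (P kap' - P 0), (l - P kap'); split.
- rewrite (@continuous_FTC2 _ f P)// ?EFinB//.
  + exact: continuous_subspaceT.
  + split.
    * by move=> z; rewrite in_itv/= => /andP[z0 _]; exact: dPx.
    * exact: P0.
    * by apply: cvg_at_left_filter; exact: cP.
  + by move=> z; rewrite in_itv/= => /andP[z0 _]; exact: P'E.
- rewrite (@ge0_continuous_FTC2y _ f P _ l)// ?EFinB//.
  + exact: continuous_subspaceT.
  + by move=> z kz; apply: dPx; exact: lt_trans kz.
  + by apply: cvg_at_right_filter; exact: cP.
  + by move=> z; rewrite in_itv/= andbT => kz; apply: P'E; exact: lt_trans kz.
lra.
Unshelve. all: by end_near. Qed.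

End Median.

(** * Bounds for the median in the four cases *)

Section MedianCases.
Variable R : realType.
Local Notation mu := (@lebesgue_measure R).
Implicit Types (u x kap m : R).

(** Bounds the median of [prof k m] by [kap] through a primitive: the mass between [kap] and any
    larger x is at most the mass of [[0, kap]]. In this form no improper integral occurs. *)
Definition median_witness (k : nat) m kap := exists P : R -> R,
  [/\ forall u, 0 < u -> is_derive u (1 : R) P (prof k m u),
      P x @[x --> 0^'+] --> P 0 &
      forall x, kap <= x -> P x + P 0 <= 2 * P kap].

Lemma ex_primitive (f : R -> R) : continuous f ->
  exists P : R -> R, forall u, 0 <= u -> is_derive u (1 : R) P (f u).
Proof.
(* Integrating from -1 makes 0 an interior point, so the derivative at 0 is two-sided. *)
move=> cf; exists (fun x => (\int[mu]_(t in `[(- 1)%R, x]) f t)%R) => u u0.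
have mf : mu.-integrable `[(- 1)%R, u + 1] (EFin \o f).
  apply: continuous_compact_integrable; first exact: segment_compact.
  exact: continuous_subspaceT.
have l1 : - 1 < u by rewrite (lt_le_trans _ u0)// ltrN10.
have l2 : u < u + 1 by rewrite ltrDl.
have [d1 d2] := continuous_FTC1_closed l2 mf l1 (cf u).
apply: DeriveDef; first exact: d1.
by rewrite -derive1E; exact: d2.
Qed.

(* The hypothesis on [sig] makes [P + P \o sig] nonincreasing. *)
Lemma median_witness_reflect k m kap (sig dsig : R -> R) : 0 < kap ->
  sig kap = kap -> (forall x, kap <= x -> 0 < sig x) ->
  (forall x, kap <= x -> is_derive x (1 : R) sig (- dsig x)) ->
  (forall x, kap <= x -> prof k m x <= dsig x * prof k m (sig x)) ->
  median_witness k m kap.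
Proof.
move=> k0 sk s0 sd sp; have [P dP] := ex_primitive (@continuous_prof R k m).
exists P; split.
- by move=> u u0; apply: dP; exact: ltW.
- apply: cvg_at_right_filter; apply: differentiable_continuous.
  apply/derivable1_diffP; exact: (@ex_derive _ _ _ _ _ _ _ (dP 0 (lexx _))).
move=> x kx.
have Pge y : 0 <= y -> P 0 <= P y.
  apply: (@is_derive_ge0_le _ P (prof k m) 0) => // z _; exact: prof_ge0.
apply: (@le_trans _ _ (P x + P (sig x))).
  by rewrite lerD2l; apply: Pge; exact/ltW/s0.
pose D x := - (P x + P (sig x)).
have : D kap <= D x.
  apply: (@is_derive_ge0_le _ D (fun x => dsig x * prof k m (sig x) - prof k m x)) => //.
    move=> z kz; have z0 := ltW (lt_le_trans k0 kz).
    have H1 := dP z z0; have H2 := dP _ (ltW (s0 _ kz)).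
    have H3 := @is_derive1_comp _ _ _ z _ _ H2 (sd _ kz).
    rewrite /D; apply: is_derive_eq.
    by rewrite mulrN opprD opprK addrC mulrC.
  by move=> z kz; rewrite subr_ge0; exact: sp.
by rewrite /D lerN2 sk -mulr2n mulr_natl.
Qed.

(** The density of s = u / (1 + u) is proportional to s^(k/2) (1 - s)^(m/2 - 2), a beta density with
    parameters k/2 + 1 and m/2 - 1, and [kap] is the value of u at its mean. The reflection
    [x -> kap ^+ 2 / x] is the symmetry of ln u about ln kap; after taking logarithms the comparison
    is [log_mean_ineq] times (m + k) / 2. *)
Lemma median_witness_mean k m kap : 2 < m -> kap = (k%:R + 2) / (m - 2) -> kap <= 1 ->
  median_witness k m kap.
Proof.
move=> m2 kE k1; have m20 : 0 < m - 2 by rewrite subr_gt0.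
have k0 : 0 < kap by rewrite kE divr_gt0// ltr_wpDl.
apply: (@median_witness_reflect k m kap (fun x => kap ^+ 2 / x) (fun x => kap ^+ 2 / x ^+ 2)) => //.
- by field; rewrite gt_eqF.
- by move=> x kx; rewrite divr_gt0 ?exprn_gt0// (lt_le_trans k0).
- move=> x kx; have x0 := lt_le_trans k0 kx.
  apply: is_derive_eq; first by apply: is_deriveM; apply: is_deriveV; rewrite gt_eqF.
  by rewrite /GRing.scale/=; field; rewrite gt_eqF.
move=> x kx; have x0 := lt_le_trans k0 kx.
have s0 : 0 < kap ^+ 2 / x by rewrite divr_gt0 ?exprn_gt0.
rewrite !profE//.
have -> : kap ^+ 2 / x ^+ 2 = expR (2 * ln kap - 2 * ln x).
  by rewrite expRD expRN !expRM_natl !lnK.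
rewrite -expRD ler_expR.
have lxk : 0 < x + kap ^+ 2 by rewrite addr_gt0 ?exprn_gt0.
have -> : ln (kap ^+ 2 / x) = 2 * ln kap - ln x.
  by rewrite ln_div ?posrE ?exprn_gt0// lnXn// mulr_natl.
have -> : ln (1 + kap ^+ 2 / x) = ln (x + kap ^+ 2) - ln x.
  rewrite -ln_div ?posrE//; congr ln; field; exact: lt0r_neq0.
have k01 : 0 < kap <= 1 by rewrite k0.
have := log_mean_ineq k01 kx.
set L := ln (x + _); set l1 := ln (1 + x); set lx := ln x; set lk := ln kap => H.
have c0 : 0 < (m + k%:R) / 2 by rewrite divr_gt0// ltr_wpDr//; lra.
have E : 2 * kap / (1 + kap) = (k%:R + 2) / ((m + k%:R) / 2).
  rewrite kE; field; rewrite !gt_eqF//=; last by lra.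
move: H; rewrite E -(ler_pM2l c0) mulrA [_ / 2 * (_ / _)]mulrC mulfVK ?gt_eqF//.
move: (m + k%:R) => c; move: (k%:R : R) => K; lra.
Qed.

(** Here [kap] is the value of u at the mode k / (k + m - 4) of the same beta density, and u / (1 +
    u) is reflected in it. Since k = kap (m - 4), the terms in ln (1 + x) cancel and [log_mode_ineq]
    remains, up to the factor (m - 4) / 2. *)
Lemma median_witness_mode k m kap : 4 < m -> kap = k%:R / (m - 4) -> 1 <= kap ->
  median_witness k m kap.
Proof.
move=> m4 kE k1; have m40 : 0 < m - 4 by rewrite subr_gt0.
have k0 : 0 < kap := lt_le_trans ltr01 k1.
have dp x : kap <= x -> 0 < 2 * x + (1 - kap) by lra.
have np x : kap <= x -> 0 < (kap - 1) * x + 2 * kap.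
  move=> kx; rewrite ltr_wpDl ?mulr_gt0// mulr_ge0// ?subr_ge0//.
  by rewrite (le_trans _ kx)// ltW.
apply: (@median_witness_reflect k m kap
  (fun x => ((kap - 1) * x + 2 * kap) / (2 * x + (1 - kap)))
  (fun x => (kap + 1) ^+ 2 / (2 * x + (1 - kap)) ^+ 2) k0).
- by field; rewrite gt_eqF// dp.
- by move=> x kx; rewrite divr_gt0 ?np ?dp.
- move=> x kx; have d0 : 2 * x + (1 - kap) != 0 by rewrite gt_eqF// dp.
  have H1 : is_derive x (1 : R) (fun t : R => 2 * t + (1 - kap)) 2.
    by apply: is_derive_eq; rewrite /GRing.scale/= mulr1 addr0.
  have H2 : is_derive x (1 : R) (fun t : R => (kap - 1) * t + 2 * kap) (kap - 1).
    by apply: is_derive_eq; rewrite /GRing.scale/= mulr1 addr0.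
  have H3 : is_derive x (1 : R) (fun t : R => (2 * t + (1 - kap))^-1)
      (- (2 * x + (1 - kap)) ^- 2 *: 2) by apply: is_deriveV.
  apply: is_derive_eq.
  by rewrite /GRing.scale/=; field.
move=> x kx; have x0 := lt_le_trans k0 kx.
have d0 := dp _ kx; have n0 := np _ kx.
have p1 : 0 < 1 + kap by rewrite addr_gt0.
rewrite !profE ?divr_gt0//.
have -> : (kap + 1) ^+ 2 / (2 * x + (1 - kap)) ^+ 2 =
    expR (2 * ln (1 + kap) - 2 * ln (2 * x + (1 - kap))).
  by rewrite expRD expRN !expRM_natl !lnK// (addrC kap).
rewrite -expRD ler_expR.
rewrite (@ln_div _ ((kap - 1) * x + 2 * kap)) ?posrE//.
have -> : ln (1 + ((kap - 1) * x + 2 * kap) / (2 * x + (1 - kap))) =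
    ln (1 + kap) + ln (1 + x) - ln (2 * x + (1 - kap)).
  have q1 : 0 < 1 + x by rewrite addr_gt0.
  rewrite -(lnM p1 q1) -(ln_div (mulr_gt0 p1 q1) d0); congr (ln _).
  by field; rewrite gt_eqF.
have := log_mode_ineq k1 kx.
set ln_ := ln ((kap - 1) * x + _); set ld := ln (2 * x + _).
set l1 := ln (1 + x); set lx := ln x; set lk := ln (1 + kap) => H.
have kE2 : k%:R = kap * (m - 4) by rewrite kE mulfVK// gt_eqF.
rewrite kE2; move: H; rewrite -(ler_pM2l m40); lra.
Qed.

Lemma sqr_powR (a : R) (n : R) : 0 < a -> (a `^ n) ^+ 2 = a `^ (n * 2).
Proof. by move=> a0; rewrite powRrM -powR_mulrn// powR_ge0. Qed.

(** For k = 0 the density (1 + u)^(-m/2) has a primitive proportional to (1 + u)^(-c) with c = (m -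
    2) / 2. Half of the mass lies below [kap] when (1 + kap)^c = 2. *)
Lemma median_witness_k0 m kap : 2 < m -> kap = 4 `^ (1 / (m - 2)) - 1 ->
  0 < kap /\ median_witness 0 m kap.
Proof.
move=> m2 kE; have m20 : 0 < m - 2 by rewrite subr_gt0.
have k0 : 0 < kap.
  rewrite kE subr_gt0 -[ltLHS](powRr0 4) /powR !gt_eqF// ltr_expR mul0r.
  by rewrite mulr_gt0 ?divr_gt0// ln_gt0// ltr1n.
split=> //; pose c := (m - 2) / 2; have c0 : 0 < c by rewrite divr_gt0.
pose P u := - ((1 + u) `^ (- c) / c).
exists P; split.
- move=> u u0; have u1 : 0 < 1 + u by rewrite addr_gt0.
  have H2 : is_derive u (1 : R) (fun u : R => 1 + u) 1.
    by rewrite -[X in is_derive _ _ _ X]add0r; apply: is_deriveD.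
  have H := @is_derive1_comp _ _ _ u _ _ (is_derive1_powR (- c) u1) H2.
  rewrite /P; apply: is_derive_eq.
  rewrite /GRing.scale/= /prof expr0 mul1r gtr0_norm// addr0 mulr1.
  have -> : - c - 1 = - (m / 2) by rewrite /c; field.
  by field; exact: lt0r_neq0.
- apply: cvgN; apply: cvgM; last exact: cvg_cst.
  apply: cvg_at_right_filter; apply: (@continuous_comp _ _ _ (fun u : R => 1 + u) (@powR R ^~ _)).
    by apply: cvgD; [exact: cvg_cst|exact: cvg_id].
  apply: differentiable_continuous; apply/derivable1_diffP.
  by apply: derivable_powR; rewrite in_itv/= addr0 ltr01.
move=> x kx; have -> : 2 * P kap = P 0; last first.
  by rewrite gerDr oppr_le0 divr_ge0 ?powR_ge0 ?ltW.
rewrite /P addr0 powR1 kE addrCA subrr addr0 -powRrM.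
have -> : 1 / (m - 2) * - c = - 2^-1 by rewrite /c; field; exact: lt0r_neq0.
have -> : (4 : R) `^ (- 2^-1) = 2^-1.
  rewrite powRN powR12_sqrt// (_ : 4 = 2 ^+ 2) ?sqrtr_sqr ?ger0_norm//.
  by rewrite -natrX.
by field; exact: lt0r_neq0.
Qed.

(** For m = 4 the density of s = u / (1 + u) is the pure power s^(k/2), with primitive s^c / c for c
    = k/2 + 1. The median is s = 2^(-1/c), which is y^2, and u = s / (1 - s). *)
Lemma median_witness_m4 k (y kap : R) :
  y = 2 `^ (- (1 / (k%:R + 2))) -> kap = y ^+ 2 / (1 - y ^+ 2) ->
  [/\ 0 < y, y < 1, 0 < kap & median_witness k 4 kap].
Proof.
move=> yE kE; pose c : R := k%:R / 2 + 1.
have c0 : 0 < c by rewrite ltr_wpDl// divr_ge0.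
have k2 : 0 < k%:R + 2 :> R by rewrite ltr_wpDl.
have y0 : 0 < y by rewrite yE powR_gt0.
have y1 : y < 1.
  rewrite yE -[ltRHS](powRr0 2) /powR !gt_eqF// ltr_expR mul0r mulNr oppr_lt0.
  by rewrite mulr_gt0 ?divr_gt0// ln_gt0// ltr1n.
have y21 : y ^+ 2 < 1 by rewrite expr_lt1// ltW.
have k0 : 0 < kap by rewrite kE divr_gt0 ?exprn_gt0// subr_gt0.
split=> //; pose P u := (u / (1 + u)) `^ c / c.
have P0 : P 0 = 0 by rewrite /P mul0r powR0 ?gt_eqF// mul0r.
have Pu u : 0 < u -> P u = expR (c * (ln u - ln (1 + u))) / c.
  move=> u0; have u1 : 0 < 1 + u by rewrite addr_gt0.
  by rewrite /P /powR gt_eqF ?divr_gt0// ln_div.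
exists P; split.
- move=> u u0; have u1 : 0 < 1 + u by rewrite addr_gt0.
  have H1 := is_derive1_ln u0.
  have H2 := @is_derive_ln_affine R 1 1 u ltac:(by rewrite mul1r addrC).
  have H3 : is_derive u (1 : R) (fun u => c * (ln u - ln (1 * u + 1)))
      (c * (u^-1 - 1 / (1 * u + 1))) by apply: is_derive_eq.
  have H4 := @is_derive1_comp _ _ _ u _ _ (is_derive_expR _) H3.
  have H5 : is_derive u (1 : R) (fun u => expR (c * (ln u - ln (1 * u + 1))) / c)
     (expR (c * (ln u - ln (1 * u + 1))) * (u^-1 - 1 / (1 * u + 1))).
    apply: is_derive_eq; rewrite /GRing.scale/=; field.
    by rewrite !lt0r_neq0// addrC.
  have E : prof k 4 u = expR (c * (ln u - ln (1 * u + 1))) * (u^-1 - 1 / (1 * u + 1)).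
    rewrite profE// mul1r (addrC u 1).
    have -> : u^-1 - 1 / (1 + u) = expR (- ln u - ln (1 + u)).
      by rewrite expRD !expRN !lnK//; field; rewrite !lt0r_neq0.
    by rewrite -expRD; congr expR; rewrite /c; field.
  rewrite E; apply: near_eq_is_derive H5.
  near=> t; have t0 : 0 < t by near: t; exact: lt_nbhsr.
  by rewrite Pu// mul1r (addrC t 1).
- rewrite P0; have sq : (fun x : R => x / c) x @[x --> 0^'+] --> 0.
    rewrite -[X in _ --> X](mul0r c^-1); apply: cvgM; last exact: cvg_cst.
    by apply: cvg_at_right_filter; exact: cvg_id.
  apply: (squeeze_cvgr _ (cvg_cst 0) sq); near=> u.
  have u0 : 0 < u by near: u; exact: nbhs_right_gt.
  have u1 : 0 < 1 + u by rewrite addr_gt0.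
  rewrite /P divr_ge0 ?powR_ge0 ?(ltW c0)//= ler_pM2r ?invr_gt0//.
  have d1 : u / (1 + u) <= u by rewrite ler_pdivrMr// ler_pMr// lerDl ltW.
  apply: le_trans d1; apply: ge1r_powR; last by rewrite /c lerDr divr_ge0.
  by rewrite divr_gt0//= ler_pdivrMr// mul1r lerDr.
move=> x kx; have x0 := lt_le_trans k0 kx; rewrite P0 addr0.
have -> : 2 * P kap = 1 / c.
  rewrite /P mulrA; congr (_ / _).
  have -> : kap / (1 + kap) = y ^+ 2.
    rewrite kE; field; rewrite gt_eqF ?subr_gt0//=.
    by rewrite subrK oner_neq0.
  rewrite yE sqr_powR// -powRrM.
  have -> : - (1 / (k%:R + 2)) * 2 * c = - 1 by rewrite /c; field; rewrite gt_eqF.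
  by rewrite powRN powRr1// divff.
rewrite /P ler_pM2r ?invr_gt0// (_ : 1 = 1 `^ c :> R); last by rewrite powR1.
rewrite ge0_ler_powR ?nnegrE ?(ltW c0)//.
  by rewrite divr_ge0 ?addr_ge0// ltW.
by rewrite ler_pdivrMr ?addr_gt0// mul1r lerDr.
Unshelve. all: by end_near. Qed.

End MedianCases.

(** * Packing *)

Section Packing.
Variable R : realType.
Local Notation mu := (@lebesgue_measure R).
Local Notation P := (measurableTypeR R * measurableTypeR R)%type.
Local Notation mu2 := (mu \x mu)%E.
Implicit Types (g h : SL2 R) (x y : P) (N k : nat) (m : R).

(* [sinh t ^ 2] for g = kappa_theta1 h_t kappa_theta2 *)
Definition sinhsq g : R := ((g 0 0 - g 1 1) ^+ 2 + (g 0 1 + g 1 0) ^+ 2) / 4.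

Lemma sinhsq_cosh g :
  1 + sinhsq g = ((g 0 0 + g 1 1) ^+ 2 + (g 0 1 - g 1 0) ^+ 2) / 4.
Proof. by rewrite /sinhsq -{1}(sl2_detE g); field. Qed.

Lemma sinhsq_ge0 g : 0 <= sinhsq g.
Proof. by rewrite divr_ge0// addr_ge0// sqr_ge0. Qed.

Lemma sl2_invE g : [/\ g^-1%g 0 0 = g 1 1, g^-1%g 0 1 = - g 0 1,
  g^-1%g 1 0 = - g 1 0 & g^-1%g 1 1 = g 0 0].
Proof.
have [h [ha hb hc hd]] := @ex_SL2 R (g 1 1) (- g 0 1) (- g 1 0) (g 0 0)
  ltac:(by rewrite -(sl2_detE g); ring).
suff -> : g^-1%g = h by [].
suff e : (h * g = 1)%g by rewrite -[RHS]mulg1 -(mulgV g) mulgA e mul1g.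
have := sl2_detE g => e; apply: SL2P; rewrite !sl2_mulE !(ha, hb, hc, hd) !mxE/=.
- by rewrite mulr1n -e; ring.
- by rewrite mulr0n; ring.
- by rewrite mulr0n; ring.
- by rewrite mulr1n -e; ring.
Qed.

Lemma sinhsqV g : sinhsq g^-1%g = sinhsq g.
Proof. by have [a b c d] := sl2_invE g; rewrite /sinhsq a b c d; field. Qed.

(* As real-linear maps of C, g z = A z + B z^* with |A|^2 = 1 + sinhsq g and
   |B|^2 = sinhsq g; the B-part of (g h) h^-1 is a difference p - q with
   |p|^2 = sinhsq (g h) (1 + sinhsq h) and |q|^2 = (1 + sinhsq (g h)) sinhsq h. *)
Lemma sinhsq_div g h : sinhsq g <=
  2 * (sinhsq (g * h)%g * (1 + sinhsq h) + (1 + sinhsq (g * h)%g) * sinhsq h).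
Proof.
have e : g = (g * h * h^-1)%g by rewrite -mulgA mulgV mulg1.
rewrite {1}e; move: (g * h)%g => {e}g; rewrite !sinhsq_cosh.
have [a b c d] := sl2_invE h; rewrite /sinhsq !sl2_mulE a b c d.
move: (g 0 0) (g 0 1) (g 1 0) (g 1 1) (h 0 0) (h 0 1) (h 1 0) (h 1 1).
move=> ga gb gc gd ha hb hc hd.
pose X := ((ga - gd) * (ha + hd) - (gb + gc) * (hc - hb)
          + (ga + gd) * (ha - hd) - (gc - gb) * (hb + hc)) / 4.
pose Y := ((ga - gd) * (hc - hb) + (gb + gc) * (ha + hd)
          + (ga + gd) * (hb + hc) + (gc - gb) * (ha - hd)) / 4.
rewrite -subr_ge0 (_ : _ - _ = X ^+ 2 + Y ^+ 2); first by rewrite addr_ge0 ?sqr_ge0.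
by rewrite /X /Y; field.
Qed.

(** [h] is the upper triangular matrix with h h^T = X. Both sides are then (tr (g X g^T) - 2) /
    4. *)
Lemma ex_section x : exists h, forall g, sinhsq (g * h)%g = hdist (act g x).
Proof.
pose s := expR (x.2 / 2); have s0 : 0 < s := expR_gt0 _.
have [h [ha hb hc hd]] := @ex_SL2 R s^-1 (x.1 / s) 0 s
  ltac:(by rewrite mulr0 subr0 mulVf// gt_eqF).
have s2 : expR x.2 = s ^+ 2 by rewrite -expRM_natl; congr expR; field.
exists h => g; rewrite hdist_act /sinhsq !sl2_mulE ha hb hc hd expRN s2.
have e2 : 2 = 2 * (g 0 0 * g 1 1 - g 0 1 * g 1 0) by rewrite sl2_detE mulr1.
rewrite [X in _ = (_ - X) / 4]e2; field; exact: lt0r_neq0.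
Qed.

(** The triangle inequality in algebraic form: if x and g x lie within distance r of i, then g moves
    i by less than 2 r, and sinh^2 r = 4 u0 (1 + u0) for u0 = sinh^2 (r/2). The factor 2 in
    [sinhsq_div] costs nothing when both distances are equal, so the constant is the sharp one. *)
Lemma sinhsq_lt g x (u0 : R) : hdist x < u0 -> hdist (act g x) < u0 ->
  sinhsq g < 4 * (u0 * (1 + u0)).
Proof.
have [h hE] := ex_section x; have := hE 1%g; rewrite act1 mul1g => <-.
rewrite -hE => h1 h2; apply: le_lt_trans (sinhsq_div g h) _.
have := sinhsq_ge0 h; have := sinhsq_ge0 (g * h)%g.
move: (sinhsq _) (sinhsq _) h1 h2 => U V Vu Uu U0 V0; nra.
Qed.

Lemma SO2P g : SO2 R g <-> sinhsq g = 0.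
Proof.
rewrite /SO2 /=; split=> [e|].
  have E i j : g i 0 * g j 0 + g i 1 * g j 1 = (1%:M : 'M[R]_2) i j.
    rewrite -e mxE !big_ord_recl big_ord0 addr0 !mxE.
    by rewrite (_ : lift ord0 ord0 = 1)//; exact: val_inj.
  have := E 0 0; have := E 1 1; rewrite !mxE/= !mulr1n => e1 e0.
  have d := sl2_detE g; rewrite /sinhsq.
  have -> : (g 0 0 - g 1 1) ^+ 2 + (g 0 1 + g 1 0) ^+ 2 = 
    g 0 0 * g 0 0 + g 0 1 * g 0 1 + (g 1 0 * g 1 0 + g 1 1 * g 1 1)
    - 2 * (g 0 0 * g 1 1 - g 0 1 * g 1 0) by ring.
  by rewrite e0 e1 d; field.
move/eqP; rewrite mulf_eq0 invr_eq0 pnatr_eq0 orbF paddr_eq0 ?sqr_ge0//.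
rewrite !sqrf_eq0 subr_eq0 addr_eq0 => /andP[/eqP ad /eqP bc].
have d := sl2_detE g; rewrite ad bc in d.
apply/matrixP => i j; rewrite mxE !big_ord_recl big_ord0 addr0 !mxE.
rewrite (_ : lift ord0 ord0 = 1); last exact: val_inj.
have o (l : 'I_2) : l = 0 \/ l = 1.
  by case: l => [[|[|//]] l2]; [left|right]; exact/val_inj.
rewrite -[ord0]/(0 : 'I_2).
by case: (o i) => ->; case: (o j) => -> /=; rewrite ?ad ?bc -?d; ring.
Qed.

(** Modulo [N] the diagonal entries agree and the others vanish, so [4 * sinhsq g] is N^2 times a
    sum of two integer squares. That sum is nonzero outside SO_2. *)
Lemma Gamma_sinhsq N g : Gamma R N g -> ~ SO2 R g -> N%:R ^+ 2 / 4 <= sinhsq g.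
Proof.
move=> [A [gA [a1 d1 b0 c0]]] nK.
have E i j : g i j = (A i j)%:~R by rewrite gA mxE.
have dv (i j : int) : (i = j %[mod N])%Z -> exists e, i - j = e * N%:Z.
  by move/eqP; rewrite eqz_mod_dvd => /dvdzP.
have [e eE] : exists e, A 0 0 - A 1 1 = e * N%:Z by apply: dv; rewrite a1 d1.
have [f fE] : exists e, A 0 1 - (- A 1 0) = e * N%:Z.
  have [q qE] := dv _ _ c0; rewrite subr0 in qE.
  apply: dv; rewrite b0.
  by rewrite qE -mulNr modzMl mod0z.
rewrite opprK in fE.
have S : sinhsq g = (e ^+ 2 + f ^+ 2)%:~R * N%:R ^+ 2 / 4.
  rewrite /sinhsq !E -rmorphB -rmorphD eE fE /= !rmorphM /= rmorphD /= !rmorphXn /=.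
  by rewrite -[(Posz N)%:~R]/(N%:R : R) !exprMn -mulrDl.
have : 1 <= e ^+ 2 + f ^+ 2.
  have : 0 <= e ^+ 2 + f ^+ 2 by rewrite addr_ge0 ?sqr_ge0.
  rewrite le_eqVlt => /predU1P[z|//].
  by case: nK; apply/SO2P; rewrite S -z mulr0z !mul0r.
move=> ge1; rewrite S ler_pM2r ?invr_gt0// ler_peMl ?sqr_ge0//.
by rewrite -[1](mulr1z 1) ler_int.
Qed.

(** Turns sums over a subset of Gamma(N) into series over [nat], for termwise integration. The index
    is the code of the integer matrix, and [b] marks the codes that occur, so finite and infinite
    subsets are treated alike. *)
Lemma enum_Gamma N (A : set (SL2 R)) : A `<=` Gamma R N ->
  exists (b : nat -> bool) (en : nat -> SL2 R),
  [/\ forall j, b j -> A (en j),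
      forall i j, b i -> b j -> en i = en j -> i = j &
      forall g, A g -> exists2 j, b j & en j = g].
Proof.
move=> AG; pose C (j : nat) := [set g | A g /\ exists M : 'M[int]_2,
  j = choice.pickle M /\ (g : 'M[R]_2) = map_mx intr M].
have Cb j : `[< C j !=set0 >] -> C j (xget 1%g (C j)).
  by move/asboolP => -[g Cg]; exact: (xgetPex _ (ex_intro _ g Cg)).
have intr_inj : injective (map_mx (intr : int -> R) : 'M[int]_2 -> 'M[R]_2).
  move=> M M' /matrixP e; apply/matrixP => i j; have := e i j; rewrite !mxE.
  exact: intr_inj.
exists (fun j => `[< C j !=set0 >]), (fun j => xget 1%g (C j)); split.
- by move=> j /Cb[].
- move=> i j /Cb[_ [M [-> Mi]]] /Cb[_ [M' [-> Mj]]] e.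
  by congr choice.pickle; apply: intr_inj; rewrite -Mi -Mj e.
move=> g Ag; have [M [gM _]] := AG _ Ag.
have Cg : C (choice.pickle M) g by split=> //; exists M.
exists (choice.pickle M); first by apply/asboolP; exists g.
have /Cb[_ [M' [/(pcan_inj choice.pickleK) <- e]]] : `[< C (choice.pickle M) !=set0 >].
  by apply/asboolP; exists g.
by apply: val_inj; rewrite /= e gM.
Qed.

Section Cutoff.
Variables (k1 u0 : R).
Hypothesis ku : k1 < u0.

(** A continuous stand-in for the indicator of the disc, as [integral_radial] asks for continuous
    integrands: 1 up to [k1], 0 from [u0] on, linear in between. *)
Definition cutoff (u : R) : R := Num.max 0 (Num.min 1 ((u0 - u) / (u0 - k1))).

Lemma cutoff_ge0 u : 0 <= cutoff u. Proof. by rewrite /cutoff le_max lexx. Qed.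

Lemma cutoff_le1 u : cutoff u <= 1.
Proof. by rewrite /cutoff ge_max ler01 ge_min lexx. Qed.

Lemma cutoff1 u : u <= k1 -> cutoff u = 1.
Proof.
move=> uk; rewrite /cutoff min_l ?max_r//.
by rewrite ler_pdivlMr ?subr_gt0// mul1r lerB.
Qed.

Lemma cutoff_neq0 u : cutoff u != 0 -> u < u0.
Proof.
apply: contraR; rewrite -leNgt => uu; rewrite /cutoff max_l// ge_min.
by rewrite ler_pdivrMr ?subr_gt0// mul0r subr_le0 uu orbT.
Qed.

Lemma continuous_cutoff : continuous cutoff.
Proof.
move=> u; apply: (@continuous_max _ _ (cst 0) (fun u => Num.min 1 ((u0 - u) / (u0 - k1)))).
  exact: cvg_cst.
apply: (@continuous_min _ _ (cst 1) (fun u => (u0 - u) / (u0 - k1))).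
  exact: cvg_cst.
apply: cvgM; last exact: cvg_cst.
by apply: cvgB; [exact: cvg_cst|exact: cvg_id].
Qed.

End Cutoff.

End Packing.

(** * Unfolding over the group *)

Section LatticeSum.
Variable R : realType.
Local Notation mu := (@lebesgue_measure R).
Local Notation P := (measurableTypeR R * measurableTypeR R)%type.
Local Notation mu2 := (mu \x mu)%E.
Variables (N k : nat) (m k1 u0 a b : R).
Variables (Gam : set (SL2 R)) (K1 : {fset SL2 R}).
Hypotheses (k1gt0 : 0 < k1) (k1u0 : k1 < u0) (u0N : 4 * (u0 * (1 + u0)) <= N%:R ^+ 2 / 4).
Hypothesis Ia : (\int[mu]_(u in `[0%R, k1]) (prof k m u)%:E = a%:E)%E.
Hypothesis Ib : (\int[mu]_(u in `[k1, +oo[) (prof k m u)%:E = b%:E)%E.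
Hypotheses (ba : b < a).
Hypothesis Gam1 : Gam 1%g.
Hypotheses (GamV : forall g, Gam g -> Gam g^-1%g).
Hypotheses (GamM : forall g h, Gam g -> Gam h -> Gam (g * h)%g).
Hypotheses (GamN : Gam `<=` Gamma R N) (K1E : [set` K1] = Gam `&` SO2 R).

Local Notation phi x := (prof k m (hdist x)).
Local Notation chi x := (cutoff k1 u0 (hdist x)).

Lemma Gam_packed g (x : P) :
  Gam g -> hdist x < u0 -> hdist (act g x) < u0 -> g \in K1.
Proof.
move=> Gg h1 h2; have := sinhsq_lt h1 h2 => lt.
suff : [set` K1] g by [].
rewrite K1E; split=> //; apply: contrapT => nK.
have := Gamma_sinhsq (GamN Gg) nK; apply/negP; rewrite -ltNge.
exact: lt_le_trans lt u0N.
Qed.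

(** If x lies in the disc, no translate by an element outside K contains it, and the sum is empty of
    nonzero terms. Otherwise the translates containing x belong to a single coset of Gamma cap K,
    and each contributes at most 1. *)
Lemma packing_sum (s : seq (SL2 R)) (x : P) : uniq s ->
  (forall g, g \in s -> Gam g /\ ~ SO2 R g) ->
  \sum_(g <- s) chi (act g^-1%g x) <= #|` K1|%:R * (1 - chi x).
Proof.
move=> us sG; rewrite (bigID (fun g => chi (act g^-1%g x) != 0)) /=.
rewrite [X in _ + X]big1 ?addr0; last by move=> g /negPn/eqP.
rewrite -big_filter; set t := [seq _ <- _ | _].
have tP g : g \in t -> [/\ Gam g, ~ SO2 R g & hdist (act g^-1%g x) < u0].
  rewrite mem_filter => /andP[/(cutoff_neq0 k1u0) h /sG[G1 G2]].
  by split.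
have ut : uniq t by rewrite filter_uniq.
have [c0|c0] := eqVneq (chi x) 0; last first.
  have xu := cutoff_neq0 k1u0 c0.
  suff -> : t = [::] by rewrite big_nil mulr_ge0// subr_ge0 cutoff_le1.
  case: t tP {ut} => // g t /(_ g (mem_head _ _))[Gg nK h].
  have : [set` K1] g^-1%g by exact: (Gam_packed (GamV Gg) xu h).
  by rewrite K1E => -[_ /SO2P]; rewrite sinhsqV => /SO2P.
rewrite c0 subr0 mulr1; apply: (@le_trans _ _ (size t)%:R).
  rewrite -sum1_size natr_sum; apply: ler_sum => g _.
  exact: cutoff_le1.
rewrite ler_nat; case: t tP ut => // g0 t tP ut.
have [G0 _ h0] := tP g0 (mem_head _ _).
(* With [g0] fixed, g -> g^-1 g0 maps the remaining elements injectively into [K1]. *)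
rewrite -(size_map (fun g => g^-1 * g0)%g); apply: uniq_leq_size.
  by rewrite map_inj_uniq// => g h /mulIg/invg_inj.
move=> _ /mapP[g gt ->]; have [Gg _ h] := tP _ gt.
apply: (Gam_packed (GamM (GamV Gg) G0) h0).
by rewrite actM -[act g0 _]actM mulgV act1.
Qed.

(** The cutoff is 1 on [[0, k1]], so the left integral is at least [a] and the right one at most
    [b]. *)
Lemma integral_cutoff_ineq :
  ((4 * pi)%:E * \int[mu]_(u in `[0%R, +oo[) (cutoff k1 u0 u * prof k m u)%:E <=
   (4 * pi)%:E * \int[mu]_(u in `[0%R, +oo[) ((1 - cutoff k1 u0 u) * prof k m u)%:E)%E ->
  False.
Proof.
have cp := @continuous_prof R k m; have cc := @continuous_cutoff R k1 u0.
have mp : measurable_fun setT (prof k m) by exact: continuous_measurable_fun.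
have mc : measurable_fun setT (cutoff k1 u0) by exact: continuous_measurable_fun.
rewrite lee_pmul2l ?fin_numE// ?lte_fin ?mulr_gt0 ?pi_gt0//; apply/negP.
rewrite -ltNge; apply: (@le_lt_trans _ _ b%:E).
  rewrite -Ib [leLHS]integral_mkcond [leRHS]integral_mkcond.
  apply: ge0_le_integral => //.
  - by move=> u _; apply: erestrict_ge0 => v _; rewrite lee_fin mulr_ge0 ?prof_ge0// subr_ge0 cutoff_le1.
  - apply/(measurable_restrictT _ _).1 => //; apply/measurable_EFinP/measurable_funTS.
    by apply: measurable_funM => //; exact: measurable_funB.
  - by apply/(measurable_restrictT _ _).1 => //; apply/measurable_EFinP/measurable_funTS.
  move=> u _; have [uk|ku] := leP u k1.
    rewrite !patchE; case: ifP => _; last by case: ifP => // _; rewrite lee_fin prof_ge0.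
    rewrite cutoff1// subrr mul0r; case: ifP => // _; rewrite lee_fin prof_ge0//.
  rewrite !patchE mem_set; last by rewrite /= in_itv/= andbT ltW// (lt_trans _ ku).
  rewrite mem_set; last by rewrite /= in_itv/= andbT ltW.
  by rewrite lee_fin ler_piMl ?prof_ge0// gerBl cutoff_ge0.
apply: (@lt_le_trans _ _ a%:E); first by rewrite lte_fin.
rewrite -Ia [leLHS](_ : _ = \int[mu]_(u in `[0%R, k1]) (cutoff k1 u0 u * prof k m u)%:E)%E.
  apply: ge0_subset_integral => //.
  - apply/measurable_EFinP/measurable_funTS; exact: measurable_funM.
  - by move=> u _; rewrite lee_fin mulr_ge0 ?prof_ge0// cutoff_ge0.
  - by move=> u /=; rewrite !in_itv/= => /andP[->].
apply: eq_integral => u /set_mem; rewrite /= in_itv/= => /andP[_ uk].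
by rewrite cutoff1// mul1r.
Qed.

(** A single [M] bounding all finite sums yields absolute convergence together with the strict
    inequality. The negation used for the contradiction includes the points where the series is
    infinite. *)
Theorem lattice_sum_lt : exists (x : P) (M : R),
  M < #|` K1|%:R * phi x /\
  forall s : seq (SL2 R), uniq s -> (forall g, g \in s -> Gam g /\ ~ SO2 R g) ->
    \sum_(g <- s) phi (act g x) <= M.
Proof.
have [B [en [enP enI enS]]] := @enum_Gamma R N (Gam `&` ~` SO2 R)
  (fun g Gg => GamN Gg.1).
pose n : R := #|` K1|%:R; have n0 : 0 <= n := ler0n _ _.
pose f j (x : P) : \bar R := (if B j then phi (act (en j) x) else 0)%:E.
have f0 j x : (0 <= f j x)%E by rewrite lee_fin; case: ifP => // _; exact: prof_ge0.
apply: contrapT => H.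
(* If this failed at x, the series would be finite there, and its value could serve as [M]. *)
have ineq x : ((n * phi x)%:E <= \sum_(0 <= j <oo) f j x)%E.
  rewrite leNgt; apply/negP => lt; apply: H.
  set S := (\sum_(0 <= j <oo) f j x)%E in lt.
  have S0 : (0 <= S)%E by exact: nneseries_ge0.
  have SE : S = (fine S)%:E.
    by rewrite fineK// ge0_fin_numE// (lt_trans lt)// ltry.
  exists x, (fine S); split; first by rewrite -lte_fin -SE.
  move=> s us sP; rewrite -lee_fin -SE.
  (* A finite family is contained in an initial part of the enumeration. *)
  have [J JP] : exists J, forall g, g \in s -> exists j, [/\ (j < J)%N, B j & en j = g].
    elim: s {us} sP => [|g s IH] sP; first by exists 0%N.
    have [|J JP] := IH; first by move=> h hs; apply: sP; rewrite inE hs orbT.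
    have [j Bj ej] := enS g (sP g (mem_head _ _)).
    exists (maxn j.+1 J) => h; rewrite inE => /predU1P[->|/JP[i [iJ Bi ei]]].
      by exists j; rewrite leq_max ltnSn.
    by exists i; rewrite leq_max iJ orbT.
  apply: le_trans (@nneseries_lim_ge _ _ xpredT 0%N J _); last by move=> *; exact: f0.
  rewrite sumEFin lee_fin -big_mkcondr /=.
  pose t := [seq en j | j <- index_iota 0 J & B j].
  have ut : uniq t.
    rewrite map_inj_in_uniq ?filter_uniq ?iota_uniq// => i j.
    by rewrite !mem_filter => /andP[Bi _] /andP[Bj _]; exact: enI.
  rewrite [leRHS](_ : _ = \sum_(g <- t) phi (act g x)); last first.
    by rewrite big_map big_filter.
  rewrite (perm_big [seq g <- t | g \in s]) /=; last first.
    apply: uniq_perm; rewrite ?filter_uniq// => g; rewrite mem_filter.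
    case gs : (g \in s) => //=; apply/esym.
    have [j [jJ Bj <-]] := JP _ gs; apply/mapP; exists j => //.
    by rewrite mem_filter Bj mem_index_iota.
  rewrite big_filter [leRHS](bigID (fun g => g \in s)) /= lerDl.
  by apply: sumr_ge0 => g _; exact: prof_ge0.
have cp := @continuous_prof R k m; have cc := @continuous_cutoff R k1 u0.
have mp : measurable_fun setT (prof k m) by exact: continuous_measurable_fun.
have mc : measurable_fun setT (cutoff k1 u0) by exact: continuous_measurable_fun.
have mh := @measurable_hdist R; have ma := @measurable_act R.
have mphi : measurable_fun setT (fun x : P => phi x) := measurableT_comp mp mh.
have mchi : measurable_fun setT (fun x : P => chi x) := measurableT_comp mc mh.
have mphia g : measurable_fun setT (fun x : P => phi (act g x)) := measurableT_comp mphi (ma g).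
have mchia g : measurable_fun setT (fun x : P => chi (act g x)) := measurableT_comp mchi (ma g).
have mf j : measurable_fun setT (f j).
  rewrite /f; case: (B j); apply/measurable_EFinP; first exact: mphia.
  exact: measurable_cst.
have mchiE : measurable_fun setT (fun x : P => (chi x)%:E) by exact/measurable_EFinP.
have m1chi : measurable_fun setT (fun x : P => 1 - chi x).
  exact: (measurable_funB (measurable_cst _) mchi).
have mcphi : measurable_fun setT (fun x : P => chi x * phi x).
  exact: (measurable_funM mchi mphi).
have m1cphi : measurable_fun setT (fun x : P => (1 - chi x) * phi x).
  exact: (measurable_funM m1chi mphi).
have mcf j : measurable_fun setT (fun x : P => ((chi x)%:E * f j x)%E).
  exact: (emeasurable_funM mchiE (mf j)).
have c0 x : (0 <= (chi x)%:E)%E by rewrite lee_fin cutoff_ge0.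
pose G j (x : P) : \bar R := (if B j then chi (act (en j)^-1%g x) * phi x else 0)%:E.
have G0 j x : (0 <= G j x)%E.
  by rewrite lee_fin; case: ifP => // _; rewrite mulr_ge0 ?prof_ge0 ?cutoff_ge0.
have mG j : measurable_fun setT (G j).
  rewrite /G; case: (B j); apply/measurable_EFinP; last exact: measurable_cst.
  exact: (measurable_funM (mchia _) mphi).
have step1 : (\int[mu2]_x (n * (chi x * phi x))%:E <=
    \int[mu2]_x \sum_(0 <= j <oo) ((chi x)%:E * f j x))%E.
  apply: ge0_le_integral => //.
  - by move=> x _; rewrite lee_fin !mulr_ge0 ?prof_ge0 ?cutoff_ge0.
  - by apply/measurable_EFinP; exact: (measurable_funM (measurable_cst _) mcphi).
  - apply: ge0_emeasurable_sum => [j x _ _|j _]; first by rewrite mule_ge0.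
    exact: mcf.
  move=> x _; rewrite nneseriesZl//.
  by rewrite mulrCA EFinM lee_wpmul2l//; exact: ineq.
(* Unfolding: for each g the substitution x -> g x turns chi (g^-1 x) phi x into chi x phi (g x). *)
have step2 : (\int[mu2]_x \sum_(0 <= j <oo) ((chi x)%:E * f j x) =
    \int[mu2]_x \sum_(0 <= j <oo) G j x)%E.
  have cf0 j x : setT x -> (0 <= (chi x)%:E * f j x)%E by rewrite mule_ge0.
  rewrite (integral_nneseries _ measurableT mcf cf0).
  rewrite (integral_nneseries _ measurableT mG (fun j x _ => G0 j x)).
  apply: eq_eseriesr => j _.
  rewrite -(act_invariantP (en j) (mG j))//; apply: eq_integral => x _.
  rewrite /f /G; case: (B j); last by rewrite mule0.
  by rewrite -actM mulVg act1 EFinM.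
have step3 : (\int[mu2]_x \sum_(0 <= j <oo) G j x <=
    \int[mu2]_x (n * ((1 - chi x) * phi x))%:E)%E.
  apply: ge0_le_integral => //.
  - by move=> x _; exact: nneseries_ge0.
  - by apply: ge0_emeasurable_sum => [j x _ _|j _]; [exact: G0|exact: mG].
  - by apply/measurable_EFinP; exact: (measurable_funM (measurable_cst _) m1cphi).
  move=> x _; apply: lime_le; first by apply: is_cvg_nneseries => *; exact: G0.
  apply: nearW => J; rewrite sumEFin lee_fin -big_mkcond /= -mulr_suml [leRHS]mulrA.
  apply: ler_wpM2r; first exact: prof_ge0.
  pose t := [seq en j | j <- index_iota 0 J & B j].
  rewrite [leLHS](_ : _ = \sum_(g <- t) chi (act g^-1%g x)); last first.
    by rewrite big_map big_filter.
  apply: packing_sum.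
    rewrite map_inj_in_uniq ?filter_uniq ?iota_uniq// => i j.
    by rewrite !mem_filter => /andP[Bi _] /andP[Bj _]; exact: enI.
  by move=> _ /mapP[j + ->]; rewrite mem_filter => /andP[/enP[]].
rewrite step2 in step1; move: (le_trans step1 step3).
have np : 0 < n.
  rewrite ltr0n cardfs_gt0; apply/fset0Pn; exists 1%g.
  suff : [set` K1] 1%g by [].
  rewrite K1E; split => //; apply/SO2P.
  by rewrite /sinhsq !mxE /= subrr addr0 expr0n /= addr0 mul0r.
under eq_integral do rewrite EFinM.
under [X in (_ <= X)%E]eq_integral do rewrite EFinM.
rewrite ge0_integralZl//; last 2 first.
- exact/measurable_EFinP.
- by move=> x _; rewrite lee_fin mulr_ge0 ?prof_ge0 ?cutoff_ge0.
rewrite ge0_integralZl//; last 2 first.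
- exact/measurable_EFinP.
- by move=> x _; rewrite lee_fin mulr_ge0 ?prof_ge0 ?subr_ge0 ?cutoff_le1.
rewrite lee_pmul2l ?fin_numE// ?lte_fin//.
rewrite (@integral_radial R (fun u => cutoff k1 u0 u * prof k m u)); last 2 first.
- by move=> u; apply: cvgM; [exact: cc|exact: cp].
- by move=> u; rewrite mulr_ge0 ?prof_ge0 ?cutoff_ge0.
rewrite (@integral_radial R (fun u => (1 - cutoff k1 u0 u) * prof k m u)); last 2 first.
- move=> u; apply: cvgM; last exact: cp.
  by apply: cvgB; [exact: cvg_cst|exact: cc].
- by move=> u; rewrite mulr_ge0 ?prof_ge0 ?subr_ge0 ?cutoff_le1.
exact: integral_cutoff_ineq.
Qed.

End LatticeSum.

(** * Unconditional sums *)

Section Summability.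
Import complex.
Local Open Scope complex_scope.
Variables (R : realType) (I : choiceType).
Implicit Types (A : set I) (f g : I -> R[i]) (s t : R[i]) (X : {fset I}).

Lemma has_sumD A f g s t : has_sum A f s -> has_sum A g t ->
  has_sum A (fun i => f i + g i) (s + t).
Proof.
move=> fs gt e e0; have e20 : 0 < e / 2 by rewrite divr_gt0.
have [X0 X0A hX] := fs _ e20; have [Y0 Y0A hY] := gt _ e20.
exists (X0 `|` Y0)%fset.
  by move=> x /=; rewrite in_fsetU => /orP[/X0A|/Y0A].
move=> X XY XA; rewrite big_split /= opprD addrACA (splitr e) rmorphD /=.
apply: le_lt_trans (ler_normD _ _) _; apply: ltrD.
  by apply: hX => //; apply: fsubset_trans XY; exact: fsubsetUl.
by apply: hY => //; apply: fsubset_trans XY; exact: fsubsetUr.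
Qed.

Lemma has_sumZ A f s (w : R[i]) : `|w| = 1 -> has_sum A f s ->
  has_sum A (fun i => w * f i) (w * s).
Proof.
move=> w1 fs e e0; have [X0 X0A hX] := fs _ e0; exists X0 => // X XX XA.
by rewrite -mulr_sumr -mulrBr normrM w1 mul1r; exact: hX.
Qed.

Lemma nonneg_has_sum A (f : I -> R) (M : R) : (forall i, 0 <= f i) ->
  (forall X, [set` X] `<=` A -> \sum_(i <- X) f i <= M) ->
  exists s, has_sum A (fun i => (f i)%:C) s.
Proof.
move=> f0 fM; pose S := [set r | exists X, [set` X] `<=` A /\ r = \sum_(i <- X) f i].
have S0 : S (\sum_(i <- fset0) f i) by exists fset0; split => // i.
have hS : has_sup S.
  split; first by eexists; exact: S0.
  by exists M => _ [X [XA ->]]; exact: fM.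
exists (sup S)%:C => e e0.
have [_ [X0 [X0A ->]] lt] := sup_adherent e0 hS.
exists X0 => // X XX XA.
have le1 : \sum_(i <- X) f i <= sup S by apply: sup_upper_bound => //; exists X.
have le2 : \sum_(i <- X0) f i <= \sum_(i <- X) f i.
  rewrite (big_fsetID _ (fun i => i \in X0) X) /=.
  rewrite (_ : [fset x in X | x \in X0]%fset = X0); last first.
    apply/fsetP => i; rewrite !inE; apply/andP/idP => [[]//|iX].
    by split=> //; apply: (fsubsetP XX).
  by rewrite lerDl; apply: sumr_ge0.
rewrite -rmorph_sum -rmorphB /= normc_def /= expr0n /= addr0 sqrtr_sqr ltcR.
rewrite ler0_norm ?subr_le0// opprB ltrBlDr -ltrBlDl.
exact: lt_le_trans lt le2.
Qed.

(** The positive and negative parts of the real and imaginary parts are four nonnegative families,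
    each dominated by the modulus. *)
Lemma abs_has_sum A f (M : R) :
  (forall X, [set` X] `<=` A -> \sum_(i <- X) `|f i| <= M%:C) ->
  exists s, has_sum A f s.
Proof.
move=> fM.
have part (g : R[i] -> R) : (forall z, 0 <= g z) -> (forall z, (g z)%:C <= `|z|) ->
    exists s, has_sum A (fun i => (g (f i))%:C) s.
  move=> g0 gle; apply: (@nonneg_has_sum _ _ M) => // X XA.
  rewrite -lecR; apply: le_trans (fM X XA); rewrite rmorph_sum /=.
  by apply: ler_sum => i _; exact: gle.
have nle (x y : R) : `|x|%:C <= `|x +i* y| /\ `|y|%:C <= `|x +i* y|.
  rewrite normc_def /= !lecR -!sqrtr_sqr; split; apply: ler_wsqrtr.
    by rewrite lerDl sqr_ge0.
  by rewrite lerDr sqr_ge0.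
have mx (x : R) : 0 <= Num.max x 0 <= `|x|.
  by rewrite le_max lexx orbT ge_max ler_norm normr_ge0.
have [s1 h1] := part (fun z => Num.max (Re z) 0) (fun z => proj1 (andP (mx _)))
  ltac:(by move=> [x y]; apply: le_trans (nle x y).1; rewrite lecR; case/andP: (mx x)).
have [s2 h2] := part (fun z => Num.max (- Re z) 0) (fun z => proj1 (andP (mx _)))
  ltac:(by move=> [x y]; apply: le_trans (nle x y).1; rewrite lecR; case/andP: (mx (- x)); rewrite normrN).
have [s3 h3] := part (fun z => Num.max (Im z) 0) (fun z => proj1 (andP (mx _)))
  ltac:(by move=> [x y]; apply: le_trans (nle x y).2; rewrite lecR; case/andP: (mx y)).
have [s4 h4] := part (fun z => Num.max (- Im z) 0) (fun z => proj1 (andP (mx _)))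
  ltac:(by move=> [x y]; apply: le_trans (nle x y).2; rewrite lecR; case/andP: (mx (- y)); rewrite normrN).
have n1 : `|-1 : R[i]| = 1 by rewrite normrN normr1.
have ni : `|'i : R[i]| = 1 by rewrite complexiE normCi.
have nNi : `|- 'i : R[i]| = 1 by rewrite normrN.
have H := has_sumD (has_sumD h1 (has_sumZ n1 h2))
  (has_sumD (has_sumZ ni h3) (has_sumZ nNi h4)).
move: H; set g := (X in has_sum A X _) => H.
exists (s1 + -1 * s2 + ('i * s3 + - 'i * s4)); suff -> : f = g by [].
apply/funext => i; rewrite /g; case: (f i) => x y /=.
have E (z : R) : Num.max z 0 - Num.max (- z) 0 = z.
  case/orP: (le_total 0 z) => z0; first by rewrite (max_l z0) max_r ?oppr_le0// subr0.
  by rewrite (max_r z0) max_l ?oppr_ge0// sub0r opprK.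
apply/eqP; rewrite eq_complex /=.
by apply/andP; split; apply/eqP; [rewrite -[LHS]E|rewrite -[LHS](E y)]; ring.
Qed.

Lemma big_fset_mem (F : I -> R[i]) X (X1 : {fset I}) :
  \sum_(i <- X | i \in X1) F i = \sum_(i <- X1 | i \in X) F i.
Proof.
rewrite -[LHS]big_filter -[RHS]big_filter; apply: perm_big; apply: uniq_perm.
- by rewrite filter_uniq ?fset_uniq.
- by rewrite filter_uniq ?fset_uniq.
- by move=> i; rewrite !mem_filter andbC.
Qed.

(** The terms outside [X1] have total modulus at most [M] and cannot cancel the sum over [X1]. The
    same bound gives summability, which excludes the default value 0 of [usum]. *)
Lemma usum_neq0 A f (X1 : {fset I}) (M : R) : [set` X1] `<=` A ->
  (forall s : seq I, uniq s -> (forall i, i \in s -> A i /\ i \notin X1) ->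
    \sum_(i <- s) `|f i| <= M%:C) ->
  M%:C < `|\sum_(i <- X1) f i| -> usum A f != 0.
Proof.
move=> X1A fM ltM.
have nR (z : R[i]) : `|z| = (Re `|z|)%:C by rewrite RRe_real ?normr_real.
have split1 X : [set` X] `<=` A -> (\sum_(i <- X | i \notin X1) `|f i| <= M%:C).
  move=> XA; rewrite -big_filter; apply: fM; first by rewrite filter_uniq ?fset_uniq.
  by move=> i; rewrite mem_filter => /andP[iX1 iX]; split=> //; exact: XA.
pose M2 := M + Re (\sum_(i <- X1) `|f i|).
have [s fs] : exists s, has_sum A f s.
  apply: (@abs_has_sum _ _ M2) => X XA; rewrite (bigID (fun i => i \in X1)) /= addrC.
  rewrite /M2 rmorphD /= lerD ?split1//.
  have -> : (Re (\sum_(i <- X1) `|f i|))%:C = \sum_(i <- X1) `|f i|.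
    by rewrite RRe_real// ger0_real// sumr_ge0.
  rewrite big_fset_mem [leRHS](bigID (fun i => i \in X)) /= lerDl.
  by rewrite sumr_ge0.
rewrite (usumE fs); apply/eqP => s0; rewrite {}s0 in fs.
(* If the sum were 0, some partial sum containing [X1] would have modulus below [e]; but the terms
   outside [X1] leave at least [e]. *)
pose e := Re `|\sum_(i <- X1) f i| - M.
have e0 : 0 < e by rewrite subr_gt0 -ltcR -nR.
have [X0 X0A] := fs _ e0.
have XA : [set` (X0 `|` X1)%fset] `<=` A.
  by move=> x /=; rewrite in_fsetU => /orP[/X0A|/X1A].
move=> /(_ _ (fsubsetUl X0 X1) XA); rewrite subr0; apply/negP; rewrite -real_leNgt ?normr_real//; last first.
  by rewrite ger0_real// lecR ltW.
rewrite (bigID (fun i => i \in X1)) /= big_fset_mem.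
have -> : \sum_(i <- X1 | i \in (X0 `|` X1)%fset) f i = \sum_(i <- X1) f i.
  rewrite big_mkcond [LHS]big_seq [RHS]big_seq; apply: eq_bigr => i iX.
  by rewrite in_fsetU iX orbT.
rewrite /e rmorphB /= -nR lerBlDr.
set S2 := (X in _ <= `|_ + X| + _).
have S2M : `|S2| <= M%:C by apply: le_trans (ler_norm_sum _ _ _) _; exact: split1.
apply: (@le_trans _ _ (`|\sum_(i <- X1) f i + S2| + `|S2|)); last by rewrite lerD2l.
by rewrite -[X in `|X| <= _](addrK S2); exact: ler_normB.
Qed.

End Summability.

(** * Cartan decomposition *)

Section Cartan.
Import complex.
Local Open Scope complex_scope.
Variable R : realType.
Implicit Types (g h : SL2 R) (k l : nat) (m t a b : R).

Lemma expiD a b : expi (a + b) = expi a * expi b.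
Proof. by rewrite /expi cosD sinD; simpc; rewrite [X in _ +i* X]addrC. Qed.

Lemma expi0 : expi 0 = 1 :> R[i].
Proof. by rewrite /expi cos0 sin0. Qed.

Lemma expiVN a : expi a * expi (- a) = 1.
Proof. by rewrite -expiD subrr expi0. Qed.

Lemma expi_neq0 a : expi a != 0.
Proof.
by apply/eqP => e; have /eqP := expiVN a; rewrite e mul0r eq_sym oner_eq0.
Qed.

Lemma expiX a n : expi a ^+ n = expi (n%:R * a).
Proof.
elim: n => [|n IH]; first by rewrite mul0r expi0.
by rewrite exprS IH -expiD -natr1 mulrDl mul1r addrC.
Qed.

Lemma norm_expi a : `|expi a| = 1.
Proof. by rewrite normc_def /= cos2Dsin2 sqrtr1. Qed.

Lemma polar (x y : R) : exists a,
  x = Num.sqrt (x ^+ 2 + y ^+ 2) * cos a /\ y = Num.sqrt (x ^+ 2 + y ^+ 2) * sin a.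
Proof.
set r := Num.sqrt _; have r0 : 0 <= r := sqrtr_ge0 _.
have rE : r ^+ 2 = x ^+ 2 + y ^+ 2 by rewrite sqr_sqrtr// addr_ge0// sqr_ge0.
have [rz|rn] := eqVneq r 0.
  exists 0; rewrite rz !mul0r; move: rE; rewrite rz expr0n /= => /esym/eqP.
  by rewrite paddr_eq0 ?sqr_ge0// !sqrf_eq0 => /andP[/eqP -> /eqP ->].
have rp : 0 < r by rewrite lt_def rn.
pose c := x / r; have xE : x = r * c by rewrite mulrC mulfVK.
pose s := y / r; have yE : y = r * s by rewrite mulrC mulfVK.
have cs : 1 - c ^+ 2 = s ^+ 2.
  apply: (mulfI (expf_neq0 2 rn)); rewrite mulrBr mulr1 -!exprMn -xE -yE rE; ring.
have c1 : -1 <= c <= 1.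
  rewrite -ler_norml -(@ler_pXn2r _ 2) ?nnegrE// real_normK ?num_real// expr1n.
  by rewrite -subr_ge0 cs sqr_ge0.
have sa := sin_acos c1; rewrite cs sqrtr_sqr in sa.
have ca : cos (acos c) = c by rewrite acosK// in_itv.
have [s0|s0] := leP 0 s.
  by exists (acos c); rewrite ca sa ger0_norm.
exists (- acos c); rewrite cosN sinN ca sa ltr0_norm// opprK; split=> //.
Qed.

Lemma cosh_sinh t : cosh t ^+ 2 - sinh t ^+ 2 = 1.
Proof.
rewrite -[RHS](expRxMexpNx_1 t) /cosh /sinh.
by move: (expR t) (expR (- t)) => x y; field.
Qed.

Lemma cosh_gt0 t : 0 < cosh t.
Proof. by rewrite divr_gt0// addr_gt0 ?expR_gt0. Qed.

Lemma sinh_ge0 t : 0 <= t -> 0 <= sinh t.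
Proof. by move=> t0; rewrite divr_ge0// subr_ge0 ler_expR ge0_cp. Qed.

Definition cartan (th1 t th2 : R) : SL2 R := (Defs.rot th1 * dil t * Defs.rot th2)%g.

(* g acts on C = R^2 by z |-> cA g * z + (cB g)^* * z^* *)
Definition cA g : R[i] := (g 0 0 + g 1 1) / 2 +i* ((g 1 0 - g 0 1) / 2).
Definition cB g : R[i] := (g 0 0 - g 1 1) / 2 +i* (- ((g 0 1 + g 1 0) / 2)).

Lemma cartanE (th1 t th2 : R) :
  [/\ cartan th1 t th2 0 0 = cosh t * cos (th1 + th2) + sinh t * cos (th1 - th2),
      cartan th1 t th2 0 1 = - cosh t * sin (th1 + th2) + sinh t * sin (th1 - th2),
      cartan th1 t th2 1 0 = cosh t * sin (th1 + th2) + sinh t * sin (th1 - th2) &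
      cartan th1 t th2 1 1 = cosh t * cos (th1 + th2) - sinh t * cos (th1 - th2)].
Proof.
rewrite /cartan !sl2_mulE !mxE /= !cosD !sinD !cosN !sinN /cosh /sinh.
by split; field.
Qed.

Lemma cA_cartan (th1 t th2 : R) :
  cA (cartan th1 t th2) = (cosh t)%:C * expi (th1 + th2).
Proof.
rewrite /cA; have [-> -> -> ->] := cartanE th1 t th2.
by rewrite /expi; simpc; congr (_ +i* _); field.
Qed.

Lemma cB_cartan (th1 t th2 : R) :
  cB (cartan th1 t th2) = (sinh t)%:C * expi (th2 - th1).
Proof.
rewrite /cB; have [-> -> -> ->] := cartanE th1 t th2.
rewrite -[th2 - th1]opprB; move: (th1 - th2) (th1 + th2) => x y.
by rewrite /expi cosN sinN; simpc; congr (_ +i* _); field.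
Qed.

Lemma sinhsq_cartan (th1 t th2 : R) : sinhsq (cartan th1 t th2) = sinh t ^+ 2.
Proof.
rewrite /sinhsq; have [-> -> -> ->] := cartanE th1 t th2.
by rewrite -[RHS]mulr1 -[X in _ = _ * X](cos2Dsin2 (th1 - th2)); field.
Qed.

(** The moduli [rA] and [rB] of [cA g] and [cB g] satisfy rA^2 - rB^2 = 1, so they are cosh t and
    sinh t with e^t = rA + rB. The arguments of [cA g] and of the conjugate of [cB g] are the sum
    and the difference of the two angles. *)
Lemma cartan_ex g : exists th1 t th2, 0 <= t /\ g = cartan th1 t th2.
Proof.
have [al []] := polar ((g 0 0 + g 1 1) / 2) ((g 1 0 - g 0 1) / 2).
have [be []] := polar ((g 0 0 - g 1 1) / 2) ((g 0 1 + g 1 0) / 2).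
set rA := Num.sqrt (((g 0 0 + g 1 1) / 2) ^+ 2 + _).
set rB := Num.sqrt (((g 0 0 - g 1 1) / 2) ^+ 2 + _).
move=> e1 e2 e3 e4.
have rA0 : 0 <= rA := sqrtr_ge0 _. have rB0 : 0 <= rB := sqrtr_ge0 _.
have AB : (rA + rB) * (rA - rB) = 1.
  by rewrite mulrC -subr_sqr !sqr_sqrtr ?addr_ge0 ?sqr_ge0// -[RHS](sl2_detE g); field.
have rA1 : 1 <= rA.
  rewrite -(@ler_pXn2r _ 2) ?nnegrE ?ler01// expr1n.
  have : rA ^+ 2 - rB ^+ 2 = 1 by rewrite subr_sqr mulrC AB.
  by have := sqr_ge0 rB; lra.
have s0 : 0 < rA + rB by lra.
pose t := ln (rA + rB); have et : expR t = rA + rB by rewrite lnK.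
have ent : expR (- t) = rA - rB.
  by rewrite expRN et; apply: (mulfI (lt0r_neq0 s0)); rewrite AB divff ?gt_eqF.
have ct : cosh t = rA by rewrite /cosh et ent; field.
have st : sinh t = rB by rewrite /sinh et ent; field.
exists ((al + be) / 2), t, ((al - be) / 2); split; first by rewrite ln_ge0//; lra.
have [ea eb ec ed] := cartanE ((al + be) / 2) t ((al - be) / 2).
rewrite (_ : (al + be) / 2 + (al - be) / 2 = al) in ea eb ec ed; last by field.
rewrite (_ : (al + be) / 2 - (al - be) / 2 = be) in ea eb ec ed; last by field.
rewrite ct st mulNr in ea eb ec ed.
by apply: SL2P; rewrite ?ea ?eb ?ec ?ed -?e1 -?e2 -?e3 -?e4; field.
Qed.

Lemma norm_Fval k m (th1 t th2 : R) : 0 <= t ->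
  `|Fval k m th1 t th2| = (prof k m (sinh t ^+ 2))%:C.
Proof.
move=> t0; rewrite /Fval !normrM !norm_expi mul1r mulr1.
have ch := cosh_gt0 t; have sh := sinh_ge0 t0.
have tk : 0 <= tanh t ^+ k / cosh t `^ m.
  by rewrite divr_ge0 ?powR_ge0// exprn_ge0// divr_ge0// ltW.
rewrite ger0_norm ?lecR//; congr (_%:C).
rewrite /prof sqrtr_sqr ger0_norm// ger0_norm ?sqr_ge0//.
have -> : 1 + sinh t ^+ 2 = cosh t ^+ 2 by rewrite -(cosh_sinh t) subrK.
rewrite -(powR_mulrn 2 (ltW ch)) -powRrM /tanh exprMn exprVn.
have -> : 2%:R * - ((m + k%:R) / 2) = - (m + k%:R) by field.
rewrite powRN powRD; last by rewrite (gt_eqF ch) implybT.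
by rewrite powR_mulrn ?ltW// invfM mulrAC -!mulrA; congr (_ * _); rewrite mulrC.
Qed.

(** In integral weight the value is a rational expression in the matrix entries. This shows that it
    does not depend on the Cartan coordinates, and it makes left translation by rotations
    computable. *)
Lemma Fval_nat k l (th1 t th2 : R) :
  Fval k l%:R th1 t th2 = cB (cartan th1 t th2) ^+ k / cA (cartan th1 t th2) ^+ (k + l).
Proof.
have ch := cosh_gt0 t; have ch0 : (cosh t)%:C != 0 by rewrite eq_complex /= gt_eqF.
rewrite cA_cartan cB_cartan !exprMn !expiX /Fval /tanh powR_mulrn ?ltW//.
move: (cosh t) (sinh t) ch ch0 => c s ch c0.
have E0 : expi ((k + l)%:R * (th1 + th2)) != 0 := expi_neq0 _.
apply: (mulIf (mulf_neq0 (expf_neq0 (k + l) c0) E0)).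
rewrite [RHS]mulfVK ?mulf_neq0 ?expf_neq0//.
have -> : ((s / c) ^+ k / c ^+ l)%:C = (s%:C / c%:C) ^+ k / c%:C ^+ l.
  by rewrite fmorph_div !rmorphXn /= fmorph_div.
rewrite (_ : expi (k%:R * (th2 - th1)) = expi (- ((l%:R + 2 * k%:R) * th1)) *
  expi (- (l%:R * th2)) * expi ((k + l)%:R * (th1 + th2))); last first.
  by rewrite -!expiD; congr expi; rewrite natrD; ring.
rewrite exprD exprMn exprVn; move: (expi _) (expi _) (expi _) => x y z.
by field; rewrite !expf_neq0.
Qed.

Lemma mp2_kappa_hyp (th1 t th2 : R) :
  mp2_sl2 (kappa th1 * hyp t * kappa th2)%g = cartan th1 t th2.
Proof.
by rewrite /= (kappaE th1).1 (hypE t).1 (kappaE th2).1.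
Qed.

Lemma FintE k l g : Fint k l%:R g = cB g ^+ k / cA g ^+ (k + l).
Proof.
have [th1 [t [th2 [t0 gE]]]] := cartan_ex g.
have [] := @xgetPex _ 0 [set w | exists th1 t th2, [/\ 0 <= t,
    g = mp2_sl2 (kappa th1 * hyp t * kappa th2)%g & w = Fval k l%:R th1 t th2]].
  by exists (Fval k l%:R th1 t th2), th1, t, th2; rewrite mp2_kappa_hyp.
move=> a1 [a [a2 [a0 e]]]; rewrite -/(Fint k l%:R g) => ->.
by rewrite Fval_nat e mp2_kappa_hyp.
Qed.

(** Whichever coordinates [xget] selects, the modulus depends only on t, and sinh^2 t is
    [sinhsq g]. *)
Lemma norm_Fint k m g : `|Fint k m g| = (prof k m (sinhsq g))%:C.
Proof.
have [th1 [t [th2 [t0 gE]]]] := cartan_ex g.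
have [] := @xgetPex _ 0 [set w | exists th1 t th2, [/\ 0 <= t,
    g = mp2_sl2 (kappa th1 * hyp t * kappa th2)%g & w = Fval k m th1 t th2]].
  by exists (Fval k m th1 t th2), th1, t, th2; rewrite mp2_kappa_hyp.
move=> a1 [a [a2 [a0 e]]]; rewrite -/(Fint k m g) => ->.
by rewrite norm_Fval// e mp2_kappa_hyp sinhsq_cartan.
Qed.

Lemma SO2_entries g : SO2 R g -> g 0 0 = g 1 1 /\ g 0 1 = - g 1 0.
Proof.
move/SO2P/eqP; rewrite mulf_eq0 invr_eq0 pnatr_eq0 orbF paddr_eq0 ?sqr_ge0//.
by rewrite !sqrf_eq0 subr_eq0 addr_eq0 => /andP[/eqP ad /eqP bc].
Qed.

(** A rotation g is multiplication by the unit complex number [cA g], so it multiplies the linear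
    part of h. *)
Lemma cA_SO2 g h : SO2 R g -> cA (g * h)%g = cA g * cA h.
Proof.
move=> /SO2_entries[ad bc]; rewrite /cA !sl2_mulE ad bc; simpc.
by congr (_ +i* _); field.
Qed.

Lemma cB_SO2 g h : SO2 R g -> cA g * cB (g * h)%g = cB h.
Proof.
move=> /SO2_entries[ad bc]; have := sl2_detE g; rewrite ad bc => d.
rewrite /cA /cB !sl2_mulE ad bc; simpc; congr (_ +i* _).
  by rewrite -[RHS]mul1r -[X in _ = X * _]d; field.
by rewrite -[RHS]mul1r -[X in _ = X * _]d; field.
Qed.

Lemma cA_neq0 g : cA g != 0.
Proof.
rewrite eq_complex /=; apply/negP => /andP[/eqP a0 /eqP b0].
have := sinhsq_cosh g; have := sinhsq_ge0 g; move: a0 b0.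
move: (g 0 0) (g 0 1) (g 1 0) (g 1 1) (sinhsq g) => a b c d s a0 b0 s0.
have -> : a = - d by lra.
have -> : b = c by lra.
by rewrite addNr subrr expr0n /= addr0 mul0r; lra.
Qed.

(** Left translation by a rotation g multiplies the value by cA(g)^-(l + 2k), which the divisibility
    hypothesis makes equal to 1. *)
Lemma Fint_SO2 k l g h n : SO2 R g -> cA g ^+ n = 1 -> (n %| l + 2 * k)%N ->
  Fint k l%:R (g * h)%g = Fint k l%:R h.
Proof.
move=> gK gn /dvdnP[q qE].
have g1 : cA g ^+ (l + 2 * k) = 1 by rewrite qE mulnC exprM gn expr1n.
rewrite !FintE -(cB_SO2 h gK) (cA_SO2 h gK).
have nz := cA_neq0 g; have nzh := cA_neq0 h.
rewrite !exprMn -[RHS]mul1r -g1; move: g1.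
rewrite (_ : (l + 2 * k = k + (k + l))%N); last by rewrite mul2n -addnn addnC addnA.
rewrite exprD => zw; rewrite zw.
have zE : cA g ^+ (k + l) = (cA g ^+ k)^-1.
  by apply: (mulfI (expf_neq0 k nz)); rewrite zw divff ?expf_neq0.
by rewrite zE invfM invrK mul1r mulrCA mulrA.
Qed.

End Cartan.

(** * The metaplectic group and half-integral weight *)

Section Half.
Import complex.
Local Open Scope complex_scope.
Variable R : realType.
Implicit Types (s t : Mp2 R) (k : nat) (m : R).
Local Notation C := (R[i])^o.

Lemma continuous_segment (z w : R[i]) (r : R) :
  ((fun r : R => (z + r%:C * w : C)) @ r --> (z + r%:C * w : C)).
Proof.
apply/(@cvgrPdist_lt _ C) => e e0.
have eE : e = (Re e)%:C by rewrite RRe_real// gtr0_real.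
have re0 : 0 < Re e by rewrite -ltcR -eE.
have wE : `|w| = (Re `|w|)%:C by rewrite RRe_real ?normr_real.
have w0 : 0 <= Re `|w| by rewrite normc_def; case: (w) => x y; exact: sqrtr_ge0.
have d0 : 0 < Re e / (Re `|w| + 1) by rewrite divr_gt0// ltr_wpDl.
near=> x.
rewrite opprD addrACA subrr add0r -mulrBl -rmorphB /= normrM wE eE.
have -> : `|(r - x)%:C| = `|r - x|%:C :> R[i].
  by rewrite normc_def /= expr0n /= addr0 sqrtr_sqr.
rewrite -rmorphM /= ltcR.
have lt : `|r - x| < Re e / (Re `|w| + 1).
  by near: x; apply: cvgr_dist_lt.
rewrite ltr_pdivlMr ?ltr_wpDl// in lt; apply: le_lt_trans lt.
by rewrite ler_wpM2l// lerDl.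
Unshelve. all: by end_near. Qed.

Lemma continuous_Re (T : topologicalType) (F : set_system T) (f : T -> C) (l : C) :
  Filter F -> f @ F --> l -> (Re (f x : R[i])) @[x --> F] --> Re (l : R[i]).
Proof.
move=> FF /(@cvgrPdist_lt _ C) fl; apply/cvgrPdist_lt => e e0.
have ec0 : 0 < e%:C :> R[i] by rewrite ltcR.
apply: filterS (fl _ ec0) => x; rewrite -raddfB -ltcR; apply: le_lt_trans.
exact: normc_ge_Re.
Qed.

(* The sign eta_s / eta_t is constant along the segment from i to z. *)
Lemma mp2_ext s t : mp2_sl2 s = mp2_sl2 t ->
  mp2_eta s (uhp_i R) = mp2_eta t (uhp_i R) -> s = t.
Proof.
move=> gE iE; apply: mp2P => // z.
pose w (r : R) : R[i] := val (uhp_i R) + r%:C * (val z - val (uhp_i R)).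
have wim (r : R) : 0 <= r <= 1 -> 0 < Im (w r).
  move=> /andP[r0 r1]; have : 0 < Im (val z) := uhp_gt0 z; rewrite /w.
  case: (val z) => x y /= y0; by simpc; rewrite /=; nra.
pose F (u : R[i]) : R[i] := ext0 (mp2_eta s) u * (ext0 (mp2_eta t) u)^-1.
have Fsq (u : uhp R) : F (val u) = 1 \/ F (val u) = -1.
  have t0 := mp2_eta_neq0 t u.
  have : F (val u) ^+ 2 == 1 ^+ 2.
    rewrite /F !ext0E exprMn exprVn !mp2_sqr gE divff ?expr1n// jfac_neq0//.
  by rewrite eqf_sqr => /orP[]/eqP ->; [left|right].
have Fd (u : uhp R) : F x @[x --> (val u : C)] --> (F (val u) : C).
  apply: (@differentiable_continuous _ C C); apply: differentiableM.
    exact: (@holomorphic_diff R (mp2_eta s) u (@mp2_hol R s)).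
  apply: differentiableV; first exact: (@holomorphic_diff R (mp2_eta t) u (@mp2_hol R t)).
  by rewrite ext0E mp2_eta_neq0.
pose rho (r : R) := Re (F (w r)).
have crho : {within `[0, 1], continuous rho}.
  apply: continuous_in_subspaceT => r /set_mem; rewrite /= in_itv /= => r01.
  apply: continuous_Re; rewrite -[w r]/(val (MkUhp (wim _ r01))).
  apply: cvg_comp (Fd (MkUhp (wim _ r01))).
  exact: continuous_segment.
have rho0 : rho 0 = 1.
  by rewrite /rho /w mul0r addr0 /F !ext0E iE divff ?mp2_eta_neq0.
have w1 : w 1 = val z by rewrite /w mul1r addrC subrK.
have rho1 : F (val z) = 1.
  have [//|F1] := Fsq z.
  have [|c] := @IVT _ rho 0 1 0 ler01 crho.
    have -> : rho 1 = -1 by rewrite /rho w1 F1.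
    by rewrite rho0 min_r ?max_l ?lerN10 ?ler01//; lra.
  rewrite in_itv /= => c01; rewrite /rho -[w c]/(val (MkUhp (wim _ c01))).
  by have [->|->] := Fsq (MkUhp (wim _ c01)) => /= /eqP; rewrite ?oppr_eq0 oner_eq0.
have t0 := mp2_eta_neq0 t z.
by apply: (mulIf (invr_neq0 t0)); rewrite divff// -rho1 /F !ext0E.
Qed.

Lemma rot2pi (a : R) : Defs.rot (a + 2 * pi) = Defs.rot a.
Proof.
by apply: val_inj; rewrite /= mulr_natl cosD2pi sinD2pi.
Qed.

(** The decomposition in SL_2 lifts up to a sign. Adding 2 pi to [th2] leaves the rotation unchanged
    and changes the sign of e^(i th2 / 2), which corrects it. *)
Lemma mp2_cartan s : exists th1 a th2 : R, 0 <= a /\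
  s = (kappa th1 * hyp a * kappa th2)%g.
Proof.
have [th1 [a [th2 [a0 gE]]]] := cartan_ex (mp2_sl2 s).
pose s1 := (kappa th1 * hyp a * kappa th2)%g.
have g1 : mp2_sl2 s = mp2_sl2 s1 by rewrite mp2_kappa_hyp.
have : mp2_eta s (uhp_i R) ^+ 2 == mp2_eta s1 (uhp_i R) ^+ 2.
  by rewrite !mp2_sqr g1.
rewrite eqf_sqr => /orP[]/eqP e.
  by exists th1, a, th2; split=> //; exact: mp2_ext.
exists th1, a, (th2 + 2 * pi); split=> //; apply: mp2_ext.
  by rewrite mp2_kappa_hyp /cartan rot2pi.
rewrite e /s1 /= (kappaE th2).1 (kappaE (th2 + 2 * pi)).1 rot2pi.
rewrite (kappaE th2).2 (kappaE (th2 + 2 * pi)).2 -mulrN; congr (_ * _).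
rewrite /expi (_ : (th2 + 2 * pi) / 2 = th2 / 2 + pi); last by field.
by rewrite cosDpi sinDpi.
Qed.

(** As in the integral case, the modulus is the same for all coordinates. The modulus suffices here,
    because Gamma cap K contributes a single term. *)
Lemma norm_Fhalf k m s : `|Fhalf k m s| = (prof k m (sinhsq (mp2_sl2 s)))%:C.
Proof.
have [th1 [t [th2 [t0 sE]]]] := mp2_cartan s.
have [] := @xgetPex _ 0 [set w | exists th1 (t : R) th2, [/\ 0 <= t,
    s = (kappa th1 * hyp t * kappa th2)%g & w = Fval k m th1 t th2]].
  by exists (Fval k m th1 t th2), th1, t, th2.
move=> a1 [a [a2 [a0 e]]]; rewrite -/(Fhalf k m s) => ->.
by rewrite norm_Fval// e mp2_kappa_hyp sinhsq_cartan.
Qed.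

End Half.

(** * The numerical conditions *)

Section Threshold.
Variable R : realType.
Implicit Types (N k : nat) (m kap : R).

(* Otherwise N^2 + 4 would be a square. *)
Lemma sixteen_mul_neq_square (A B N : nat) : (0 < A)%N -> (0 < B)%N ->
  (16 * A * (A + B))%N <> (N ^ 2 * B ^ 2)%N.
Proof.
move=> A0 B0 e.
(* Completing the square. Hence B divides 4 A + 2 B, and the quotient squares to N^2 + 4. *)
have e2 : ((N ^ 2 + 4) * B ^ 2 = (4 * A + 2 * B) ^ 2)%N.
  by rewrite mulnDl -e; ring.
have /dvdnP[Q QE] : (B %| 4 * A + 2 * B)%N.
  by rewrite -(@dvdn_pexp2r _ _ 2)// -e2 dvdn_mull.
have Q2 : (N ^ 2 + 4 = Q ^ 2)%N.
  by apply/eqP; rewrite -(@eqn_pmul2r (B ^ 2)) ?expn_gt0 ?B0// e2 QE expnMn.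
have N0 : (0 < N)%N.
  by case: N e e2 Q2 => // /eqP; rewrite mul0n !muln_eq0 addn_eq0 !eqn0Ngt A0.
have lt : (N < Q)%N by rewrite -(@ltn_exp2r _ _ 2)// -Q2 -addn1 leq_add2l.
have [j jE] : exists j, Q = (N + j.+1)%N by exists (Q - N.+1)%N; rewrite addnS -addSn subnKC.
move: Q2; rewrite jE sqrnD => /eqP; rewrite -addnA eqn_add2l.
case: j {jE} => [|[|j]].
- by rewrite muln1 => /eqP/(congr1 odd); rewrite oddD oddM.
- by rewrite muln2 -addnn; case: N N0 {e e2 lt} => // n _; rewrite !mulnS.
- move=> /eqP h; have : (3 ^ 2 <= j.+3 ^ 2)%N by rewrite leq_exp2r.
  by rewrite leqNgt; case/negP; rewrite ltnS; apply: leq_trans (_ : 4 <= _)%N => //; rewrite h leq_addr.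
Qed.

(** With [kap] rational, equality would read 16 A (A + B) = N^2 B^2, which [sixteen_mul_neq_square]
    excludes. *)
Lemma threshold_strict (A B N : nat) kap : (0 < A)%N -> (0 < B)%N ->
  kap = A%:R / B%:R -> 4 * Num.sqrt (kap * (1 + kap)) <= N%:R ->
  16 * (kap * (1 + kap)) < N%:R ^+ 2.
Proof.
move=> A0 B0 kE; have Bn : B%:R != 0 :> R by rewrite pnatr_eq0 -lt0n.
have k0 : 0 < kap by rewrite kE divr_gt0 ?ltr0n.
have p0 : 0 <= kap * (1 + kap) by rewrite mulr_ge0 ?addr_ge0 ?ltW.
rewrite -(@ler_pXn2r _ 2) ?nnegrE ?mulr_ge0 ?sqrtr_ge0//.
rewrite exprMn sqr_sqrtr// (_ : 4 ^+ 2 = 16); last by rewrite -natrX.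
move=> le; rewrite lt_neqAle le andbT.
apply/eqP => e; apply: (@sixteen_mul_neq_square A B N A0 B0).
apply/eqP; rewrite -(eqr_nat R) !(natrX, natrD, natrM) -e kE.
by apply/eqP; field.
Qed.

(** Each condition compares [N] with 4 sqrt (kap (1 + kap)) for the median bound [kap] of its case.
    In case (1), 1 + kap = y^2 with y = 2^(1/(m - 2)); in case (2), kap (1 + kap) = (1/y - y)^-2
    with y = 2^(-1/(k + 2)). *)
Lemma median_threshold N k m :
  (exists n : nat, m = 5 / 2 + n%:R / 2) ->
  [\/ k = 0%N /\
       4 * 2 `^ (1 / (m - 2)) * Num.sqrt (4 `^ (1 / (m - 2)) - 1) < N%:R,
      m = 4 /\
       4 / (2 `^ (1 / (k%:R + 2)) - 2 `^ (- (1 / (k%:R + 2)))) < N%:R :> R,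
      [/\ (0 < k)%N, k%:R <= m - 4 &
       4 * Num.sqrt ((k%:R + 2) / (m - 2) * (1 + (k%:R + 2) / (m - 2))) <= N%:R] |
      [/\ 0 < m - 4, m - 4 <= k%:R &
       4 * Num.sqrt (k%:R / (m - 4) * (1 + k%:R / (m - 4))) <= N%:R]] ->
  exists kap, [/\ 0 < kap, median_witness k m kap & 16 * (kap * (1 + kap)) < N%:R ^+ 2].
Proof.
move=> [n mE]; have m2 : 2 < m by rewrite mE; have := ler0n R n; lra.
have m20 : 0 < m - 2 by rewrite subr_gt0.
case=> [[-> lt]|[-> lt]|[k0 km le]|[m4 mk le]].
- have [kp w] := @median_witness_k0 R m _ m2 erefl.
  exists (4 `^ (1 / (m - 2)) - 1); split=> //.
  move: lt kp; set y := 2 `^ _ => lt kp.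
  have yE : 4 `^ (1 / (m - 2)) = y ^+ 2.
    by rewrite expr2 -powRM// -natrM.
  move: lt; rewrite -(@ltr_pXn2r _ 2) ?nnegrE ?mulr_ge0 ?powR_ge0 ?sqrtr_ge0//.
  by rewrite !exprMn sqr_sqrtr ?ltW// yE; lra.
- have [y0 y1 kp w] := @median_witness_m4 R k _ _ erefl erefl.
  eexists; split; [exact: kp|exact: w|].
  move: lt y0 y1 {kp w}; rewrite (_ : 2 `^ (1 / (k%:R + 2)) = (2 `^ (- (1 / (k%:R + 2))))^-1); last first.
    by rewrite powRN invrK.
  move: (2 `^ _) => y lt y0 y1.
  have y2 : 0 < 1 - y ^+ 2 by rewrite subr_gt0 expr_lt1// ltW.
  have d : y^-1 - y = (1 - y ^+ 2) / y by field; rewrite gt_eqF.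
  move: lt; rewrite -(@ltr_pXn2r _ 2) ?nnegrE//; last first.
    by rewrite d divr_ge0// divr_ge0// ltW.
  rewrite d; congr (_ < _); field; rewrite !gt_eqF//.
- exists ((k%:R + 2) / (m - 2)); split.
  (* As m - 2 = (n + 1) / 2, the mean is the ratio of the positive integers 2 k + 4 and n + 1. *)
  + by rewrite divr_gt0// ltr_wpDl.
  + apply: median_witness_mean => //; rewrite ler_pdivrMr// mul1r; lra.
  + apply: (@threshold_strict (2 * k + 4) n.+1) => //; first by rewrite addn_gt0 orbT.
    rewrite mE natrD natrM -natr1; field; have := ler0n R n => nn.
    by rewrite !gt_eqF//; lra.
- exists (k%:R / (m - 4)); have k0 : 0 < k%:R :> R by lra.
  have n3 : (3 < n)%N by rewrite -(ltr_nat R); lra.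
  split; first by rewrite divr_gt0.
  + by apply: median_witness_mode => //; [lra|rewrite ler_pdivlMr// mul1r].
  (* As m - 4 = (n - 3) / 2, the mode is 2 k / (n - 3); here n > 3 because m > 4. *)
  + apply: (@threshold_strict (2 * k) (n - 3)) => //.
    * by rewrite muln_gt0 /= -(ltr0n R).
    * by rewrite subn_gt0.
    * have e : (n - 3)%:R = n%:R - 3 :> R by rewrite natrB// ltnW.
      have nn : 3 < n%:R :> R by rewrite ltr_nat.
      rewrite mE e natrM; field; rewrite !gt_eqF//; lra.
Qed.

End Threshold.

(** * Nonvanishing of the Poincare series *)

Section Main.
Import complex.
Local Open Scope complex_scope.
Variable R : realType.
Implicit Types (N k l : nat) (m kap : R).

(** Restates the lattice estimate on the group: the point found in the half-plane is represented by
    an element [h], and |F(g h)| is then a function of [sinhsq]. *)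
Lemma lattice_gap N k m kap (Gam : set (SL2 R)) (K1 : {fset SL2 R}) :
  0 < kap -> median_witness k m kap -> 16 * (kap * (1 + kap)) < N%:R ^+ 2 ->
  Gam 1%g -> (forall g h, Gam g -> Gam h -> Gam (g * h)%g) ->
  (forall g, Gam g -> Gam g^-1%g) -> Gam `<=` Gamma R N ->
  [set` K1] = Gam `&` SO2 R ->
  exists (h : SL2 R) (M : R), M < #|` K1|%:R * prof k m (sinhsq h) /\
  forall s : seq (SL2 R), uniq s -> (forall g, g \in s -> Gam g /\ ~ SO2 R g) ->
    \sum_(g <- s) prof k m (sinhsq (g * h)%g) <= M.
Proof.
move=> k0 [P [dP P0 med]] lt G1 GM GV GN K1E.
(* [u0] is the positive root of 16 u0 (1 + u0) = N^2, the largest disc allowed by the packing. The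
   cutoff starts halfway between [kap] and [u0]. *)
pose r : R := Num.sqrt (4 + N%:R ^+ 2) / 2; pose u0 := (r - 1) / 2.
have r0 : 0 <= r by rewrite divr_ge0// sqrtr_ge0.
have r2 : r ^+ 2 = 1 + N%:R ^+ 2 / 4.
  rewrite expr_div_n sqr_sqrtr ?addr_ge0 ?sqr_ge0//.
  by rewrite (_ : 2 ^+ 2 = 4 :> R) -?natrX//; field.
have ku : kap < u0.
  have : (2 * kap + 1) ^+ 2 < r ^+ 2 by rewrite r2; nra.
  rewrite ltr_pXn2r ?nnegrE ?addr_ge0 ?mulr_ge0 ?ltW// /u0; lra.
have kk : kap < (kap + u0) / 2 by lra.
have ku2 : (kap + u0) / 2 < u0 by lra.
have uN : 4 * (u0 * (1 + u0)) <= N%:R ^+ 2 / 4.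
  rewrite [leRHS](_ : _ = r ^+ 2 - 1) ?r2; last by ring.
  by rewrite -r2 /u0 le_eqVlt; apply/orP; left; apply/eqP; field.
have [a [b [Ia Ib ba]]] := median_lt (@continuous_prof R k m) (@prof_ge0 R k m)
  (@prof_gt0 R k m) dP P0 k0 med kk.
have [x [M [Mlt sM]]] := lattice_sum_lt (lt_trans k0 kk) ku2 uN Ia Ib ba G1 GV GM GN K1E.
have [h hE] := ex_section x; exists h, M; split.
  by have := hE 1%g; rewrite mul1g act1 => ->.
move=> s us sG; apply: le_trans (sM s us sG).
by rewrite le_eqVlt; apply/orP; left; apply/eqP; apply: eq_bigr => g _; rewrite hE.
Qed.

Lemma group_closed_mem (G : groupType) (Gam : set G) : group_closed (mem Gam) ->
  [/\ Gam 1%g, forall x y, Gam x -> Gam y -> Gam (x * y)%g &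
      forall x, Gam x -> Gam x^-1%g].
Proof.
move=> gc; split.
- by have [/set_mem] := gc.
- by move=> x y Gx Gy; apply/set_mem/(group_closedM gc); exact/mem_set.
- by move=> x Gx; apply/set_mem/(group_closedV gc)/mem_set.
Qed.

(** Only moduli enter, and they factor through SL_2. The projection is injective on [Gam] and its
    image meets SO_2 in the identity alone, so the one term at the identity dominates all others
    together. *)
Lemma poincare_half_neq0 N k m kap (Gam : set (Mp2 R)) :
  0 < kap -> median_witness k m kap -> 16 * (kap * (1 + kap)) < N%:R ^+ 2 ->
  group_closed (mem Gam) -> Gam `<=` Gammamp R N ->
  Gam `&` Kmp R = [set 1%g] ->
  exists s : Mp2 R, poincare Gam (Fhalf k m) s != 0.
Proof.
move=> k0 med lt /group_closed_mem[G1 GM GV] GN GK.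
(* The kernel of the covering lies in K. *)
have inj s t : Gam s -> Gam t -> mp2_sl2 s = mp2_sl2 t -> s = t.
  move=> Gs Gt e; suff : (Gam `&` Kmp R) (s * t^-1)%g.
    by rewrite GK /= => /(canRL (mulgVK _)) ->; rewrite mul1g.
  split; first by apply: GM => //; exact: GV.
  by rewrite /Kmp /= e mulgV; apply/SO2P; rewrite /sinhsq !mxE /= subrr addr0 expr0n /= addr0 mul0r.
pose Gam' := @mp2_sl2 R @` Gam.
have K1E : [set` [fset (1%g : SL2 R)]%fset] = Gam' `&` SO2 R.
  rewrite set_fset1; apply/seteqP; split=> [_ ->|_ [[s Gs <-] sK]].
    have : (Gam `&` Kmp R) 1%g by rewrite GK.
    by move=> [H1 H2]; split; [exists 1%g|exact: H2].
  have : (Gam `&` Kmp R) s by [].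
  by rewrite GK => ->.
have [||||h [M [Mlt sM]]] := @lattice_gap N k m kap Gam' _ k0 med lt _ _ _ _ K1E.
- by exists 1%g.
- by move=> _ _ [s Gs <-] [t Gt <-]; exists (s * t)%g => //; exact: GM.
- by move=> _ [s Gs <-]; exists s^-1%g => //; exact: GV.
- by move=> _ [s Gs <-]; exact: (GN s Gs).
have [eh _] := mp2_ofE (sqr_sqrtc (jfac h (val (uhp_i R)))).
pose t := mp2_of h (sqrtc (jfac h (val (uhp_i R)))).
exists t; apply: (@usum_neq0 R _ Gam _ [fset (1%g : Mp2 R)]%fset M).
- by rewrite set_fset1 => _ ->.
- move=> s us sG; under eq_bigr do rewrite norm_Fhalf /= eh.
  rewrite -rmorph_sum lecR -(big_map (@mp2_sl2 R) xpredT (fun g => prof k m (sinhsq (g * h)%g))).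
  apply: sM.
    by rewrite map_inj_in_uniq// => x y /sG[Gx _] /sG[Gy _]; exact: inj.
  move=> _ /mapP[x /sG[Gx x1] ->]; split; first by exists x.
  move=> xK; have : (Gam `&` Kmp R) x by [].
  by rewrite GK /= => xE; move: x1; rewrite xE in_fset1 eqxx.
rewrite big_seq_fset1 mul1g norm_Fhalf eh ltcR.
by move: Mlt; rewrite cardfs1 mul1r.
Qed.

Lemma SO2M (g h : SL2 R) : SO2 R g -> SO2 R h -> SO2 R (g * h)%g.
Proof.
rewrite /SO2 /= => gK hK.
by rewrite trmx_mul mulmxA -(mulmxA _ _ (h^T)) hK mulmx1.
Qed.

(** The [n] terms from Gamma cap SO_2 all equal F(h), so they add up without cancellation to n F(h),
    which dominates the rest. *)
Lemma poincare_int_neq0 N k l kap (Gam : set (SL2 R)) (n : nat) :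
  0 < kap -> median_witness k l%:R kap -> 16 * (kap * (1 + kap)) < N%:R ^+ 2 ->
  group_closed (mem Gam) -> Gam `<=` Gamma R N ->
  (Gam `&` SO2 R #= `I_n)%card -> (n %| l + 2 * k)%N ->
  exists g : SL2 R, poincare Gam (Fint k l%:R) g != 0.
Proof.
move=> k0 med lt /group_closed_mem[G1 GM GV] GN Kn nl.
have [K1 K1E] : exists K1 : {fset SL2 R}, Gam `&` SO2 R = [set` K1].
  by apply/finite_fsetP; exists n.
have K1n : #|` K1| = n by apply/card_eq_fsetP; rewrite -K1E.
have K1P g : g \in K1 <-> Gam g /\ SO2 R g.
  by split=> [gK|Kg]; [suff : (Gam `&` SO2 R) g by []; rewrite K1E|
    suff : [set` K1] g by []; rewrite -K1E].
(* Lagrange for the finite group [K1]: translation by g permutes [K1] and multiplies the product of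
   all [cA] by [cA g ^+ n]. *)
have ord g : g \in K1 -> cA g ^+ n = 1.
  move=> gK; have /K1P[Gg Kg] := gK.
  have pe : perm_eq [seq (g * h)%g | h <- K1] K1.
    have u1 : uniq [seq (g * h)%g | h <- K1].
      by rewrite map_inj_uniq ?fset_uniq// => x y /mulgI.
    apply: uniq_perm => //; apply: (uniq_min_size u1 _ _).2.
      move=> _ /mapP[h /K1P[Gh Kh] ->]; apply/K1P; split; first exact: GM.
      exact: SO2M.
    by rewrite size_map.
  have Q0 : \prod_(h <- K1) cA h != 0 by rewrite prodf_seq_neq0; apply/allP => h _; exact: cA_neq0.
  apply: (mulIf Q0); rewrite mul1r -{2}(perm_big _ pe) big_map /=.
  under [RHS]eq_bigr do rewrite cA_SO2//.
  by rewrite big_split /= big_const_seq count_predT iter_mulr_1 K1n.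
have [h [M [Mlt sM]]] := lattice_gap k0 med lt G1 GM GV GN (esym K1E).
exists h; apply: (@usum_neq0 R _ Gam _ K1 M).
- by move=> g /K1P[].
- move=> s us sG; under eq_bigr do rewrite norm_Fint.
  rewrite -rmorph_sum lecR; apply: sM => // g /sG[Gg gK]; split=> // Kg.
  by move/negP: gK; apply; apply/K1P.
rewrite big_seq (eq_bigr (fun=> Fint k l%:R h)); last first.
  move=> g gK; have /K1P[_ Kg] := gK; exact: Fint_SO2 Kg (ord _ gK) nl.
rewrite -big_seq big_const_seq count_predT iter_addr_0 normrMn norm_Fint.
by rewrite -rmorphMn /= ltcR -mulr_natl.
Qed.

End Main.

Local Open Scope card_scope.

Theorem corollary6p18 (R : realType) (N k : nat) (m : R) :
  (0 < N)%N ->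
  (exists n : nat, m = 5 / 2 + n%:R / 2) ->
  [\/ k = 0%N /\
       4 * 2 `^ (1 / (m - 2)) * Num.sqrt (4 `^ (1 / (m - 2)) - 1) < N%:R,
      m = 4 /\
       4 / (2 `^ (1 / (k%:R + 2)) - 2 `^ (- (1 / (k%:R + 2)))) < N%:R :> R,
      [/\ (0 < k)%N, k%:R <= m - 4 &
       4 * Num.sqrt ((k%:R + 2) / (m - 2) * (1 + (k%:R + 2) / (m - 2))) <= N%:R] |
      [/\ 0 < m - 4, m - 4 <= k%:R &
       4 * Num.sqrt (k%:R / (m - 4) * (1 + k%:R / (m - 4))) <= N%:R]] ->
  ((exists n : nat, m = 5 / 2 + n%:R) ->
   forall Gam : set (Mp2 R),
     group_closed (mem Gam) -> Gam `<=` Gammamp R N ->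
     Gam `&` Kmp R = [set 1%g] ->
     exists s : Mp2 R, poincare Gam (Fhalf k m) s != 0) /\
  (forall l : nat, (3 <= l)%N -> m = l%:R ->
   forall Gam : set (SL2 R),
     group_closed (mem Gam) -> Gam `<=` Gamma R N ->
     (exists2 n : nat, Gam `&` SO2 R #= `I_n & (n %| l + 2 * k)%N) ->
     exists g : SL2 R, poincare Gam (Fint k m) g != 0).
Proof.
move=> _ mE cond; have [kap [k0 med lt]] := median_threshold mE cond.
split=> [_ Gam gc GN GK|l _ mlE Gam gc GN [n Kn nl]].
  exact: (poincare_half_neq0 k0 med lt gc GN GK).
rewrite mlE in med *; exact: (poincare_int_neq0 k0 med lt gc GN Kn nl).
Qed.
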